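(* A category $\mathbb{C}$ having finite products and sums (coproducts) has, up to isomorphism, at most one conormal emd-noetherian form, and the following conditions on $\mathbb{C}$ are equivalent: (i) $\mathbb{C}$ has a conormal emd-noetherian form. (ii) $\mathbb{C}$ is a pointed category having an emd-noetherian form. (iii) $\mathbb{C}$ is a pointed category having a conormal noetherian form having an exact decomposition. (iv) $\mathbb{C}$ is a pointed category having a conormal noetherian form. (v) $\mathbb{C}$ is a pointed category having a noetherian form such that inverse images of conormal clusters are conormal and bottom clusters are conormal. (vi) $\mathbb{C}$ is a semi-abelian category in the sense of Janelidze–Márki–Tholen.
   Context: A category is semi-abelian (Janelidze–Márki–Tholen) if it is pointed, has finite coproducts, is Barr exact and is (Bourn) protomodular. ''Pointed'' means having a zero object. Forms. A form over a category $\mathbb{C}$ is a faithful functor $F\colon\mathbb{B}\to\mathbb{C}$ that is amnestic (an isomorphism of $\mathbb{B}$ sent to an identity morphism is an identity morphism). Objects of $\mathbb{B}$ sent to $X$ are called ($F$-)clusters in $X$. For $f\colon X\to Y$, a cluster $A$ in $X$ and a cluster $B$ in $Y$, $B\geq_f A$ means that some morphism $A\to B$ of $\mathbb{B}$ is sent to $f$; $\geq$ denotes $\geq_{1_X}$, a partial order on the clusters in $X$. $F$ is orean if: (O1) for each $X$ the clusters in $X$ form a bounded lattice ($\bot_X,\top_X,\vee,\wedge$); (O2) for $f\colon X\to Y$, $g\colon Y\to Z$, if $C\geq_{gf}A$ then there is a cluster $B$ in $Y$ with $C\geq_g B$ and $B\geq_f A$; (O3) for $f\colon X\to Y$ and a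 cluster $S$ in $X$ there is a least cluster $f\cdot S$ in $Y$ among those $T$ with $T\geq_f S$ (direct image), and for a cluster $T$ in $Y$ there is a largest cluster $T\cdot f$ in $X$ among those $S$ with $T\geq_f S$ (inverse image). For $f\colon X\to Y$ put $\mathrm{Im} f=f\cdot\top_X$, $\mathrm{Ker} f=\bot_Y\cdot f$. A cluster is conormal (normal) if it is the image (kernel) of some morphism. An orean form is conormal (normal) if all its clusters are. Operators. An operator $\tau\colon F\to G$ between forms over $\mathbb{C}$ is a functor between the domains with $G\circ\tau=F$; equivalently, a map of clusters over each object such that $B\geq_f A$ implies $\tau B\geq_f\tau A$. Isomorphisms of forms are invertible operators. A collection of $F$-clusters, with the relations $\geq_f$ restricted, is a subform of $F$. For an idempotent operator $\tau\colon F\to F$, $F_\tau$ is the subform of clusters $S$ with $\tau S=S$. An operator of orean forms is conormal if $\tau(\mathrm{Im}^F f)=\mathrm{Im}^G f$ for all $f$, normal if $\tau(\mathrm{Ker}^F f)=\mathrm{Ker}^G f$ for all $f$, binormal if both. Noetherian forms. For an orean form, an embedding of a conormal cluster $S$ in $X$ is a morphism $m\colon W\to X$ with $\mathrm{Im}\, m=S$ such that every $m'\colon W'\to X$ with $\mathrm{Im}\, m'\leq S$ factors uniquely as $m'=mg$. A quotient of a normal cluster $S$ in $X$ is a morphism $q\colon X\to Y$ with $\mathrm{Ker}\, q=S$ such that every $q'\colon X\to Y'$ with $\mathrm{Ker}\, q'\geq S$ factors uniquely as $q'=hq$. An orean form is noetherian if: (N1) for every $f\colon X\to Y$, $(f\cdot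 S)\cdot f=S\vee\mathrm{Ker} f$ for all clusters $S$ in $X$, and $f\cdot(T\cdot f)=T\wedge\mathrm{Im} f$ for all clusters $T$ in $Y$; (N2) every morphism $f$ factors as $f=me$ with $m$ an embedding of $\mathrm{Im} f$ and $e$ a quotient of $\mathrm{Ker} f$; (N3) the join of two normal clusters is normal and the meet of two conormal clusters is conormal. Decompositions. A decomposition of an orean form $F$ is a pair $(\kappa_s,\kappa_e)$ of idempotent operators $F\to F$ such that $F_s=F_{\kappa_s}$ is a conormal orean form, $F_e=F_{\kappa_e}$ is a normal orean form, and there is a term $t(x,y)$ among $\top,\bot,x,y,x\vee y,x\wedge y$ with $S=t(\kappa_s S,\kappa_e S)$ for every cluster $S$. It is a meet decomposition if one can take $t=x\wedge y$. It is exact if the restrictions $\tau_s\colon F\to F_s$, $\tau_e\colon F\to F_e$ of $\kappa_s,\kappa_e$ are binormal, there exist a conormal operator $F_s\to F_e$ and a normal operator $F_e\to F_s$, the subform inclusion $F_s\to F$ is conormal and the subform inclusion $F_e\to F$ is normal. An emd-noetherian form is a noetherian form admitting an exact meet decomposition. *)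

(* Defs.v *)
From mathcomp Require Import all_boot.
From Stdlib Require Import ProofIrrelevance.

Set Implicit Arguments.
Unset Strict Implicit.
Unset Printing Implicit Defensive.

Declare Scope cat_scope.
Delimit Scope cat_scope with cat.
Local Open Scope cat_scope.

(** * Categories and functors *)

Record category := Category {
  ob :> Type;
  hom : ob -> ob -> Type;
  idm : forall X, hom X X;
  comp : forall X Y Z, hom Y Z -> hom X Y -> hom X Z;
  comp_idl : forall X Y (f : hom X Y), comp (idm Y) f = f;
  comp_idr : forall X Y (f : hom X Y), comp f (idm X) = f;
  comp_assoc : forall X Y Z W (h : hom Z W) (g : hom Y Z) (f : hom X Y),
    comp h (comp g f) = comp (comp h g) f
}.
Arguments hom {c} X Y.
Arguments idm {c} X.
Arguments comp {c X Y Z} g f.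

Notation "g ∘ f" := (comp g f) (at level 40, left associativity) : cat_scope.

Record functor (B C : category) := Functor {
  fob :> B -> C;
  fmap : forall X Y, hom X Y -> hom (fob X) (fob Y);
  fmap_id : forall X, fmap (idm X) = idm (fob X);
  fmap_comp : forall X Y Z (g : hom Y Z) (f : hom X Y),
    fmap (g ∘ f) = fmap g ∘ fmap f
}.
Arguments fmap {B C} f {X Y} h : rename.

Definition is_iso (C : category) (X Y : C) (f : hom X Y) : Prop :=
  exists g : hom Y X, g ∘ f = idm X /\ f ∘ g = idm Y.

(* [is_identity f] forces the domain and the codomain of [f] to coincide. *)
Inductive is_identity (C : category) (X : C) : forall Y : C, hom X Y -> Prop :=
  | IsIdentity : is_identity (idm X).

Definition hom_cast (C : category) (X X' Y Y' : C) (eX : X = X') (eY : Y = Y')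
    (f : hom X Y) : hom X' Y' :=
  match eX in _ = X1, eY in _ = Y1 return hom X1 Y1 with
  | erefl, erefl => f
  end.

(** * Limits, colimits and zero objects *)

Section Limits.
Variable C : category.

Definition is_terminal (T : C) : Prop := forall X : C, exists! f : hom X T, True.
Definition is_initial (I : C) : Prop := forall X : C, exists! f : hom I X, True.
Definition pointed : Prop := exists Z : C, is_terminal Z /\ is_initial Z.

Definition is_product (I : Type) (X : I -> C) (P : C)
    (pr : forall i, hom P (X i)) : Prop :=
  forall (W : C) (w : forall i, hom W (X i)),
    exists! u : hom W P, forall i, pr i ∘ u = w i.

Definition is_coproduct (I : Type) (X : I -> C) (S : C)
    (inj : forall i, hom (X i) S) : Prop :=
  forall (W : C) (w : forall i, hom (X i) W),
    exists! u : hom S W, forall i, u ∘ inj i = w i.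

Definition has_finite_products : Prop :=
  forall (I : finType) (X : I -> C),
    exists (P : C) (pr : forall i, hom P (X i)), is_product pr.

Definition has_finite_coproducts : Prop :=
  forall (I : finType) (X : I -> C),
    exists (S : C) (inj : forall i, hom (X i) S), is_coproduct inj.

Definition is_limit (J : category) (D : functor J C) (L : C)
    (pr : forall j : J, hom L (D j)) : Prop :=
  (forall (i j : J) (a : hom i j), fmap D a ∘ pr i = pr j) /\
  forall (W : C) (w : forall j : J, hom W (D j)),
    (forall (i j : J) (a : hom i j), fmap D a ∘ w i = w j) ->
    exists! u : hom W L, forall j, pr j ∘ u = w j.

Definition finite_type (T : Type) : Prop :=
  exists (I : finType) (e : I -> T), forall x, exists i, e i = x.

Definition finite_category (J : category) : Prop :=
  finite_type J /\ forall i j : J, finite_type (hom i j).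

Definition has_finite_limits : Prop :=
  forall (J : category) (D : functor J C), finite_category J ->
    exists (L : C) (pr : forall j : J, hom L (D j)), is_limit pr.

(* p1 : P -> X and p2 : P -> Y form a pullback of f : X -> Z and g : Y -> Z. *)
Definition is_pullback (P X Y Z : C) (p1 : hom P X) (p2 : hom P Y)
    (f : hom X Z) (g : hom Y Z) : Prop :=
  f ∘ p1 = g ∘ p2 /\
  forall (W : C) (w1 : hom W X) (w2 : hom W Y), f ∘ w1 = g ∘ w2 ->
    exists! u : hom W P, p1 ∘ u = w1 /\ p2 ∘ u = w2.

Definition is_coequalizer (X Y Q : C) (f g : hom X Y) (q : hom Y Q) : Prop :=
  q ∘ f = q ∘ g /\
  forall (W : C) (w : hom Y W), w ∘ f = w ∘ g -> exists! u : hom Q W, u ∘ q = w.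

Definition is_regular_epi (Y Q : C) (q : hom Y Q) : Prop :=
  exists (X : C) (f g : hom X Y), is_coequalizer f g q.

Definition is_kernel_pair (R X Y : C) (r1 r2 : hom R X) (f : hom X Y) : Prop :=
  is_pullback r1 r2 f f.

(** * Barr exact, protomodular and semi-abelian categories *)

(* Internal equivalence relations; in the last clause, [P] with [p1], [p2] is
   the object of pairs of composable elements of the relation. *)
Definition is_equivalence_relation (R X : C) (r1 r2 : hom R X) : Prop :=
  [/\ forall (W : C) (a b : hom W R),
        r1 ∘ a = r1 ∘ b -> r2 ∘ a = r2 ∘ b -> a = b,
      exists d : hom X R, r1 ∘ d = idm X /\ r2 ∘ d = idm X,
      exists s : hom R R, r1 ∘ s = r2 /\ r2 ∘ s = r1
    & forall (P : C) (p1 p2 : hom P R), is_pullback p1 p2 r2 r1 ->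
        exists t : hom P R, r1 ∘ t = r1 ∘ p1 /\ r2 ∘ t = r2 ∘ p2].

Definition regular_category : Prop :=
  [/\ has_finite_limits,
      forall (R X Y : C) (r1 r2 : hom R X) (f : hom X Y),
        is_kernel_pair r1 r2 f ->
        exists (Q : C) (q : hom X Q), is_coequalizer r1 r2 q
    & forall (P X Y Z : C) (p1 : hom P X) (p2 : hom P Y) (f : hom X Z)
        (g : hom Y Z), is_pullback p1 p2 f g ->
        is_regular_epi g -> is_regular_epi p1].

Definition barr_exact : Prop :=
  regular_category /\
  forall (R X : C) (r1 r2 : hom R X), is_equivalence_relation r1 r2 ->
    exists (Y : C) (f : hom X Y), is_kernel_pair r1 r2 f.

Record point (B : C) := Point {
  pt_ob : C;
  pt_proj : hom pt_ob B;
  pt_sec : hom B pt_ob;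
  pt_split : pt_proj ∘ pt_sec = idm B
}.

Definition point_hom (B : C) (P Q : point B) : Type :=
  {h : hom (pt_ob P) (pt_ob Q) |
    pt_proj Q ∘ h = pt_proj P /\ h ∘ pt_sec P = pt_sec Q}.

Lemma point_hom_eq (B : C) (P Q : point B) (h k : point_hom P Q) :
  sval h = sval k -> h = k.
Proof. by case: h k => h ph [k pk] /= e; apply: subset_eq_compat. Qed.

Definition point_id (B : C) (P : point B) : point_hom P P.
Proof. by exists (idm _); split; rewrite ?comp_idl ?comp_idr. Defined.

Definition point_comp (B : C) (P Q R : point B) (k : point_hom Q R)
    (h : point_hom P Q) : point_hom P R.
Proof.
exists (sval k ∘ sval h); case: k h => k [k1 k2] [h [h1 h2]] /=; split.
- by rewrite comp_assoc k1.
- by rewrite -comp_assoc h2.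
Defined.

Definition points (B : C) : category.
Proof.
apply: (@Category (point B) (@point_hom B) (@point_id B) (@point_comp B)).
- by move=> P Q f; apply: point_hom_eq; rewrite /= comp_idl.
- by move=> P Q f; apply: point_hom_eq; rewrite /= comp_idr.
- by move=> P Q R S h g f; apply: point_hom_eq; rewrite /= comp_assoc.
Defined.

(* [Q], together with [u], is the pullback of the point [P] along [f]. *)
Definition is_change_of_base (E B : C) (f : hom E B) (P : point B) (Q : point E)
    (u : hom (pt_ob Q) (pt_ob P)) : Prop :=
  is_pullback (pt_proj Q) u f (pt_proj P) /\ u ∘ pt_sec Q = pt_sec P ∘ f.

(* Pullbacks of points exist, and the change-of-base functors
   f^* : points B -> points E are conservative: [k] below is f^*(h) for the
   pullbacks [Q], [Q'] of [P], [P'], and the condition is imposed for every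
   choice of pullbacks. *)
Definition protomodular : Prop :=
  (forall (E B : C) (f : hom E B) (P : point B),
     exists (Q : point E) (u : hom (pt_ob Q) (pt_ob P)),
       is_change_of_base f u) /\
  (forall (E B : C) (f : hom E B) (P P' : points B) (Q Q' : points E)
     (u : hom (pt_ob Q) (pt_ob P)) (u' : hom (pt_ob Q') (pt_ob P'))
     (h : hom P P') (k : hom Q Q'),
     is_change_of_base f u -> is_change_of_base f u' ->
     u' ∘ sval k = sval h ∘ u -> is_iso k -> is_iso h).

Definition semi_abelian : Prop :=
  [/\ pointed, has_finite_coproducts, barr_exact & protomodular].

End Limits.

(** * Forms *)

Record form (C : category) := Form {
  fdom : category;
  ffun :> functor fdom C;
  form_faithful : forall (A B : fdom) (h k : hom A B),
    fmap ffun h = fmap ffun k -> h = k;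
  form_amnestic : forall (A B : fdom) (h : hom A B),
    is_iso h -> is_identity (fmap ffun h) -> is_identity h
}.

Definition cluster (C : category) (F : form C) (X : C) : Type :=
  {A : fdom F | F A = X}.

(* [cgeq f T S] is the relation T >=_f S. *)
Definition cgeq (C : category) (F : form C) (X Y : C) (f : hom X Y)
    (T : cluster F Y) (S : cluster F X) : Prop :=
  exists h : hom (sval S) (sval T),
    hom_cast (proj2_sig S) (proj2_sig T) (fmap F h) = f.

Definition cle (C : category) (F : form C) (X : C) (S T : cluster F X) : Prop :=
  cgeq (idm X) T S.

Record orean (C : category) (F : form C) := Orean {
  bot : forall X : C, cluster F X;
  top : forall X : C, cluster F X;
  join : forall X : C, cluster F X -> cluster F X -> cluster F X;
  meet : forall X : C, cluster F X -> cluster F X -> cluster F X;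
  dimg : forall X Y : C, hom X Y -> cluster F X -> cluster F Y;
  iimg : forall X Y : C, hom X Y -> cluster F Y -> cluster F X;
  bot_least : forall (X : C) (S : cluster F X), cle (bot X) S;
  top_greatest : forall (X : C) (S : cluster F X), cle S (top X);
  join_lub : forall (X : C) (S T : cluster F X),
    [/\ cle S (join S T), cle T (join S T)
      & forall U, cle S U -> cle T U -> cle (join S T) U];
  meet_glb : forall (X : C) (S T : cluster F X),
    [/\ cle (meet S T) S, cle (meet S T) T
      & forall U, cle U S -> cle U T -> cle U (meet S T)];
  cgeq_factor : forall (X Y Z : C) (f : hom X Y) (g : hom Y Z)
    (A : cluster F X) (D : cluster F Z),
    cgeq (g ∘ f) D A -> exists B : cluster F Y, cgeq g D B /\ cgeq f B A;
  dimg_least : forall (X Y : C) (f : hom X Y) (S : cluster F X),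
    cgeq f (dimg f S) S /\ forall T, cgeq f T S -> cle (dimg f S) T;
  iimg_largest : forall (X Y : C) (f : hom X Y) (T : cluster F Y),
    cgeq f T (iimg f T) /\ forall S, cgeq f T S -> cle S (iimg f T)
}.

(* All the operations of [orean] are uniquely determined by the form. *)
Record orean_form (C : category) := OreanForm {
  of_form :> form C;
  of_orean : orean of_form
}.

Section OreanForms.
Variables (C : category) (F : orean_form C).

Definition fbot (X : C) : cluster F X := bot (of_orean F) X.
Definition ftop (X : C) : cluster F X := top (of_orean F) X.
Definition fjoin (X : C) (S T : cluster F X) : cluster F X :=
  join (of_orean F) S T.
Definition fmeet (X : C) (S T : cluster F X) : cluster F X :=
  meet (of_orean F) S T.
Definition direct (X Y : C) (f : hom X Y) (S : cluster F X) : cluster F Y :=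
  dimg (of_orean F) f S.
Definition inverse (X Y : C) (f : hom X Y) (T : cluster F Y) : cluster F X :=
  iimg (of_orean F) f T.

Definition Im (X Y : C) (f : hom X Y) : cluster F Y := direct f (ftop X).
Definition Ker (X Y : C) (f : hom X Y) : cluster F X := inverse f (fbot Y).

Definition conormal_cluster (X : C) (S : cluster F X) : Prop :=
  exists (W : C) (f : hom W X), Im f = S.
Definition normal_cluster (X : C) (S : cluster F X) : Prop :=
  exists (Y : C) (f : hom X Y), Ker f = S.

Definition conormal_form : Prop :=
  forall (X : C) (S : cluster F X), conormal_cluster S.
Definition normal_form : Prop :=
  forall (X : C) (S : cluster F X), normal_cluster S.

Definition is_embedding (X : C) (S : cluster F X) (W : C) (m : hom W X) : Prop :=
  Im m = S /\
  forall (W' : C) (m' : hom W' X), cle (Im m') S ->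
    exists! g : hom W' W, m' = m ∘ g.

Definition is_quotient (X : C) (S : cluster F X) (Y : C) (q : hom X Y) : Prop :=
  Ker q = S /\
  forall (Y' : C) (q' : hom X Y'), cle S (Ker q') ->
    exists! h : hom Y Y', q' = h ∘ q.

Definition noetherian : Prop :=
  [/\ forall (X Y : C) (f : hom X Y),
        (forall S, inverse f (direct f S) = fjoin S (Ker f)) /\
        (forall T, direct f (inverse f T) = fmeet T (Im f)),
      forall (X Y : C) (f : hom X Y),
        exists (W : C) (e : hom X W) (m : hom W Y),
          [/\ f = m ∘ e, is_embedding (Im f) m & is_quotient (Ker f) e],
      forall (X : C) (S T : cluster F X),
        normal_cluster S -> normal_cluster T -> normal_cluster (fjoin S T)
    & forall (X : C) (S T : cluster F X),
        conormal_cluster S -> conormal_cluster T ->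
        conormal_cluster (fmeet S T)].

End OreanForms.
Arguments fbot {C} F X.
Arguments ftop {C} F X.
Arguments Im {C} F {X Y} f.
Arguments Ker {C} F {X Y} f.

(** * Operators *)

Record operator (C : category) (F G : form C) := Operator {
  opfun :> forall X : C, cluster F X -> cluster G X;
  op_mono : forall (X Y : C) (f : hom X Y) (S : cluster F X) (T : cluster F Y),
    cgeq f T S -> cgeq f (opfun T) (opfun S)
}.
Arguments opfun {C F G} o X S : rename.

Definition isomorphic_forms (C : category) (F G : form C) : Prop :=
  exists (s : operator F G) (t : operator G F),
    (forall (X : C) (S : cluster F X), t X (s X S) = S) /\
    (forall (X : C) (T : cluster G X), s X (t X T) = T).

Definition idempotent_op (C : category) (F : form C) (tau : operator F F) : Prop :=
  forall (X : C) (S : cluster F X), tau X (tau X S) = tau X S.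

Definition conormal_op (C : category) (F G : orean_form C) (tau : operator F G) :
    Prop :=
  forall (X Y : C) (f : hom X Y), tau Y (Im F f) = Im G f.
Definition normal_op (C : category) (F G : orean_form C) (tau : operator F G) :
    Prop :=
  forall (X Y : C) (f : hom X Y), tau X (Ker F f) = Ker G f.
Definition binormal_op (C : category) (F G : orean_form C) (tau : operator F G) :
    Prop :=
  conormal_op tau /\ normal_op tau.

(** * Subforms *)

Definition full_subcategory (B : category) (P : B -> Prop) : category :=
  @Category {A : B | P A} (fun A A' => hom (sval A) (sval A'))
    (fun A => idm (sval A)) (fun _ _ _ g f => g ∘ f)
    (fun _ _ f => comp_idl f) (fun _ _ f => comp_idr f)
    (fun _ _ _ _ h g f => comp_assoc h g f).

Section Subforms.
Variables (C : category) (F : form C) (P : forall X : C, cluster F X -> Prop).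

Definition self_cluster (A : fdom F) : cluster F (F A) := exist _ A erefl.

Definition subform_dom : category :=
  full_subcategory (fun A : fdom F => P (self_cluster A)).

Definition subform_functor : functor subform_dom C :=
  @Functor subform_dom C (fun A => F (sval A)) (fun _ _ h => fmap F h)
    (fun A => fmap_id F (sval A)) (fun _ _ _ g f => fmap_comp F g f).

Lemma full_subcategory_identity (B : category) (Q : B -> Prop)
    (A A' : full_subcategory Q) (h : hom A A') :
  @is_identity B (sval A) (sval A') h -> is_identity h.
Proof.
case: A A' h => [a qa] [a' qa'] /= h i; case: i qa' => qa'.
rewrite (proof_irrelevance _ qa' qa); exact: IsIdentity.
Qed.

Lemma subform_amnestic (A B : subform_dom) (h : hom A B) :
  is_iso h -> is_identity (fmap subform_functor h) -> is_identity h.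
Proof.
move=> [g [e1 e2]] i; apply: full_subcategory_identity.
by apply: form_amnestic i; exists g.
Qed.

Definition subform : form C :=
  @Form C subform_dom subform_functor
    (fun A B h k e => @form_faithful C F (sval A) (sval B) h k e)
    subform_amnestic.

Definition sub_val (X : C) (S : cluster subform X) : cluster F X :=
  exist _ (sval (sval S)) (proj2_sig S).

Lemma self_clusterP (X : C) (S : cluster F X) : P S -> P (self_cluster (sval S)).
Proof. by case: S => A e; case: X / e. Qed.

Definition sub_mk (X : C) (S : cluster F X) (PS : P S) : cluster subform X :=
  exist (fun A : subform_dom => F (sval A) = X)
    (exist _ (sval S) (self_clusterP PS)) (proj2_sig S).

Definition sub_incl : operator subform F :=
  @Operator C subform F sub_val (fun _ _ _ _ _ H => H).

End Subforms.

(* The subform F_tau of the clusters fixed by tau. *)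
Definition fixed_form (C : category) (F : form C) (tau : operator F F) : form C :=
  subform (fun (X : C) (S : cluster F X) => tau X S = S).

Definition fixed_incl (C : category) (F : form C) (tau : operator F F) :
  operator (fixed_form tau) F := @sub_incl C F _.

(* The restriction F -> F_tau of an idempotent operator tau. *)
Definition fixed_proj (C : category) (F : form C) (tau : operator F F)
    (tau_idem : idempotent_op tau) : operator F (fixed_form tau) :=
  @Operator C F (fixed_form tau) (fun X S => sub_mk (tau_idem X S))
    (fun X Y f S T H => op_mono tau H).

(** * Decompositions *)

Inductive lattice_term :=
  | TTop | TBot | TFst | TSnd | TJoin | TMeet.

Definition eval_term (C : category) (F : orean_form C) (t : lattice_term) (X : C)
    (x y : cluster F X) : cluster F X :=
  match t with
  | TTop => ftop F X
  | TBot => fbot F X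
  | TFst => x
  | TSnd => y
  | TJoin => fjoin x y
  | TMeet => fmeet x y
  end.

Definition decomposes_by (C : category) (F : orean_form C) (ks ke : operator F F)
    (t : lattice_term) : Prop :=
  forall (X : C) (S : cluster F X), S = eval_term t (ks X S) (ke X S).

Record decomposition (C : category) (F : orean_form C) := Decomposition {
  kap_s : operator F F;
  kap_e : operator F F;
  kap_s_idem : idempotent_op kap_s;
  kap_e_idem : idempotent_op kap_e;
  dec_s_orean : orean (fixed_form kap_s);
  dec_e_orean : orean (fixed_form kap_e);
  dec_s_conormal : conormal_form (OreanForm dec_s_orean);
  dec_e_normal : normal_form (OreanForm dec_e_orean);
  dec_term : exists t : lattice_term, decomposes_by kap_s kap_e t
}.

Section Decompositions.
Variables (C : category) (F : orean_form C) (D : decomposition F).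

Definition form_s : orean_form C := OreanForm (dec_s_orean D).
Definition form_e : orean_form C := OreanForm (dec_e_orean D).

Definition tau_s : operator F form_s := fixed_proj (@kap_s_idem C F D).
Definition tau_e : operator F form_e := fixed_proj (@kap_e_idem C F D).
Definition incl_s : operator form_s F := fixed_incl (kap_s D).
Definition incl_e : operator form_e F := fixed_incl (kap_e D).

Definition meet_decomposition : Prop := decomposes_by (kap_s D) (kap_e D) TMeet.

Definition exact_decomposition : Prop :=
  [/\ binormal_op tau_s /\ binormal_op tau_e,
      exists sigma : operator form_s form_e, conormal_op sigma,
      exists sigma : operator form_e form_s, normal_op sigma,
      conormal_op incl_s
    & normal_op incl_e].

End Decompositions.

Definition has_exact_decomposition (C : category) (F : orean_form C) : Prop :=
  exists D : decomposition F, exact_decomposition D.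

Definition emd_noetherian (C : category) (F : orean_form C) : Prop :=
  noetherian F /\
  exists D : decomposition F, exact_decomposition D /\ meet_decomposition D.

(* Main.v *)
Require Import Defs.
From mathcomp Require Import all_boot.
From Stdlib Require Import ProofIrrelevance FunctionalExtensionality.
From Stdlib Require Import PropExtensionality IndefiniteDescription.

(* (i)-(v) imply (vi).  A morphism [w : W -> X] is inside a cluster [S] when its
   image lies below [S]; embeddings represent conormal clusters in this sense.
   Under (v), kernels are conormal, monomorphisms are the morphisms with zero
   kernel and are embeddings, and regular epimorphisms are the morphisms with full
   image and are cokernels of their kernels; the lattice identities (N1) and (N3)
   then give each of the axioms.  An exact meet decomposition of [F] satisfies
   [S <= kap_s S], where [kap_s] fixes exactly the conormal clusters, whence (v).

   (vi) implies (i).  Subobjects form a conormal form, in which [w] is inside a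
   direct image [f S] when it lifts along [f] to [S] after composition with a
   regular epimorphism.  Take [kap_s] to be the identity and [kap_e] the normal
   closure; the latter exists, and joins of normal subobjects are normal, because
   reflexive relations are effective equivalence relations.

   Uniqueness.  In a conormal noetherian form over a pointed category the clusters
   of [X] are the subobjects of [X]. *)

Set Implicit Arguments.
Unset Strict Implicit.
Unset Printing Implicit Defensive.

(** * Calculus of clusters *)


Section FormCalculus.
Local Open Scope cat_scope.
Variable C : category.

Section Forms.
Variable F : form C.

Lemma hom_cast_comp (X X' Y Y' Z Z' : C) (eX : X = X') (eY : Y = Y')
    (eZ : Z = Z') (g : hom Y Z) (f : hom X Y) :
  hom_cast eX eZ (g ∘ f) = hom_cast eY eZ g ∘ hom_cast eX eY f.
Proof. by case: X' / eX; case: Y' / eY; case: Z' / eZ. Qed.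

Lemma hom_cast_id (X X' : C) (e : X = X') : hom_cast e e (idm X) = idm X'.
Proof. by case: X' / e. Qed.

Lemma hom_cast_inj (X X' Y Y' : C) (eX : X = X') (eY : Y = Y') (f g : hom X Y) :
  hom_cast eX eY f = hom_cast eX eY g -> f = g.
Proof. by case: X' / eX; case: Y' / eY. Qed.

Lemma is_identity_cast (X Y W : C) (eX : X = W) (eY : Y = W) (f : hom X Y) :
  hom_cast eX eY f = idm W -> is_identity f.
Proof. by case: W / eY eX => eX; case: Y / eX f => f /= ->; exact: IsIdentity. Qed.

Lemma cgeq_comp (X Y Z : C) (f : hom X Y) (g : hom Y Z) (S : cluster F X)
    (T : cluster F Y) (U : cluster F Z) :
  cgeq g U T -> cgeq f T S -> cgeq (g ∘ f) U S.
Proof.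
by move=> [k <-] [h <-]; exists (k ∘ h); rewrite fmap_comp (hom_cast_comp _ (proj2_sig T)).
Qed.

Lemma cle_refl (X : C) (S : cluster F X) : cle S S.
Proof. by exists (idm _); rewrite fmap_id hom_cast_id. Qed.

Lemma cle_trans (X : C) (T S U : cluster F X) : cle S T -> cle T U -> cle S U.
Proof. by move=> h k; rewrite /cle -(comp_idl (idm X)); exact: cgeq_comp h. Qed.

Lemma cgeq_cle (X Y : C) (f : hom X Y) (S S' : cluster F X) (T T' : cluster F Y) :
  cgeq f T S -> cle S' S -> cle T T' -> cgeq f T' S'.
Proof.
move=> h s t; rewrite -(comp_idl f) -(comp_idr f).
by apply: cgeq_comp t _; apply: cgeq_comp h s.
Qed.

(** The witnesses of the two inequalities are mutually inverse by faithfulness and lie over an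
    identity, so amnesticity makes [h] an identity. What remains is the irrelevance of the proofs
    that the object lies over [X]. *)
Lemma cle_anti (X : C) (S T : cluster F X) : cle S T -> cle T S -> S = T.
Proof.
move=> [h eh] [k ek].
have i : is_identity h.
  apply: form_amnestic (is_identity_cast eh).
  exists k; split; apply: (@form_faithful _ F); rewrite fmap_comp fmap_id.
    apply: (hom_cast_inj (eX := proj2_sig S) (eY := proj2_sig S)).
    by rewrite (hom_cast_comp _ (proj2_sig T)) eh ek comp_idl hom_cast_id.
  apply: (hom_cast_inj (eX := proj2_sig T) (eY := proj2_sig T)).
  by rewrite (hom_cast_comp _ (proj2_sig S)) eh ek comp_idl hom_cast_id.
case: S T h k eh ek i => A eA [B eB] /= h k _ _ i {k}.
by case: B h / i eB => eB; congr exist; exact: proof_irrelevance.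
Qed.

End Forms.

Section Orean.
Variable F : orean_form C.

Definition inside (W X : C) (S : cluster F X) (w : hom W X) : Prop :=
  cgeq w S (ftop F W).

Lemma le_top (X : C) (S : cluster F X) : cle S (ftop F X).
Proof. exact: top_greatest. Qed.

Lemma ge_bot (X : C) (S : cluster F X) : cle (fbot F X) S.
Proof. exact: bot_least. Qed.

Lemma top_le (X : C) (S : cluster F X) : cle (ftop F X) S -> S = ftop F X.
Proof. by apply: cle_anti; exact: le_top. Qed.

Lemma le_bot (X : C) (S : cluster F X) : cle S (fbot F X) -> S = fbot F X.
Proof. by move/cle_anti; apply; exact: ge_bot. Qed.

Lemma join_le (X : C) (S T U : cluster F X) :
  cle (fjoin S T) U <-> cle S U /\ cle T U.
Proof.
have [l r h] := join_lub (of_orean F) S T.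
split=> [le_U | [SU TU]]; last exact: h.
by split; apply: cle_trans le_U.
Qed.

Lemma le_meet (X : C) (S T U : cluster F X) :
  cle U (fmeet S T) <-> cle U S /\ cle U T.
Proof.
have [l r h] := meet_glb (of_orean F) S T.
split=> [le_U | [SU TU]]; last exact: h.
by split; apply: cle_trans le_U _.
Qed.

Lemma le_joinl (X : C) (S T : cluster F X) : cle S (fjoin S T).
Proof. by have /join_le [] := cle_refl (fjoin S T). Qed.

Lemma le_joinr (X : C) (S T : cluster F X) : cle T (fjoin S T).
Proof. by have /join_le [] := cle_refl (fjoin S T). Qed.

Lemma join_bot (X : C) (S : cluster F X) : fjoin S (fbot F X) = S.
Proof.
apply: cle_anti (le_joinl _ _).
by apply/join_le; split; [exact: cle_refl | exact: ge_bot].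
Qed.

Lemma meet_top (X : C) (S : cluster F X) : fmeet S (ftop F X) = S.
Proof.
apply: cle_anti; first by have /le_meet [] := cle_refl (fmeet S (ftop F X)).
by apply/le_meet; split; [exact: cle_refl | exact: le_top].
Qed.

Lemma direct_cgeq (X Y : C) (f : hom X Y) (S : cluster F X) (T : cluster F Y) :
  cle (direct f S) T <-> cgeq f T S.
Proof.
have [h m] := dimg_least (of_orean F) f S.
split=> [le_T|]; [exact: cgeq_cle h (cle_refl S) le_T | exact: m].
Qed.

Lemma inverse_cgeq (X Y : C) (f : hom X Y) (S : cluster F X) (T : cluster F Y) :
  cle S (inverse f T) <-> cgeq f T S.
Proof.
have [h m] := iimg_largest (of_orean F) f T.
split=> [le_S|]; [exact: cgeq_cle h le_S (cle_refl T) | exact: m].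
Qed.

Lemma direct_inverse (X Y : C) (f : hom X Y) (S : cluster F X) (T : cluster F Y) :
  cle (direct f S) T <-> cle S (inverse f T).
Proof. exact: iff_trans (direct_cgeq _ _ _) (iff_sym (inverse_cgeq _ _ _)). Qed.

(** Forwards this is (O2), as the intermediate cluster lies below [inverse g U]. Functoriality of
    direct and inverse images follows. *)
Lemma cgeq_factors (X Y Z : C) (f : hom X Y) (g : hom Y Z) (S : cluster F X)
    (U : cluster F Z) : cgeq (g ∘ f) U S <-> cgeq f (inverse g U) S.
Proof.
split=> [/(cgeq_factor (of_orean F)) [T [gT fT]] | h].
  by apply: cgeq_cle fT (cle_refl S) _; apply/inverse_cgeq.
by apply: cgeq_comp h; apply/inverse_cgeq; exact: cle_refl.
Qed.

Lemma cle_eqP (X : C) (S T : cluster F X) :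
  (forall U, cle S U <-> cle T U) -> S = T.
Proof. by move=> h; apply: cle_anti; apply/h; exact: cle_refl. Qed.

Lemma direct_comp (X Y Z : C) (g : hom Y Z) (f : hom X Y) (S : cluster F X) :
  direct (g ∘ f) S = direct g (direct f S).
Proof.
apply: cle_eqP => U; rewrite direct_cgeq cgeq_factors -direct_cgeq.
exact: iff_sym (direct_inverse _ _ _).
Qed.

Lemma inverse_comp (X Y Z : C) (g : hom Y Z) (f : hom X Y) (U : cluster F Z) :
  inverse (g ∘ f) U = inverse f (inverse g U).
Proof.
apply: cle_anti.
  by apply/inverse_cgeq/cgeq_factors/inverse_cgeq; exact: cle_refl.
by apply/inverse_cgeq/cgeq_factors/inverse_cgeq; exact: cle_refl.
Qed.

Lemma direct_mono (X Y : C) (f : hom X Y) (S T : cluster F X) :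
  cle S T -> cle (direct f S) (direct f T).
Proof.
by move=> le_ST; apply/direct_inverse/(cle_trans le_ST)/direct_inverse; exact: cle_refl.
Qed.

Lemma inverse_mono (X Y : C) (f : hom X Y) (S T : cluster F Y) :
  cle S T -> cle (inverse f S) (inverse f T).
Proof.
move=> le_ST; apply/direct_inverse/(cle_trans _ le_ST)/direct_inverse.
exact: cle_refl.
Qed.

Lemma direct_bot (X Y : C) (f : hom X Y) : direct f (fbot F X) = fbot F Y.
Proof. by apply: le_bot; apply/direct_inverse; exact: ge_bot. Qed.

Lemma Im_comp (X Y Z : C) (g : hom Y Z) (f : hom X Y) :
  Im F (g ∘ f) = direct g (Im F f).
Proof. exact: direct_comp. Qed.

Lemma Ker_comp (X Y Z : C) (g : hom Y Z) (f : hom X Y) :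
  Ker F (g ∘ f) = inverse f (Ker F g).
Proof. exact: inverse_comp. Qed.

Lemma Im_id (X : C) : Im F (idm X) = ftop F X.
Proof. by apply: top_le; apply/direct_cgeq; exact: cle_refl. Qed.

Lemma Ker_id (X : C) : Ker F (idm X) = fbot F X.
Proof. by apply: le_bot; apply/inverse_cgeq; exact: cle_refl. Qed.

Lemma Ker_le_comp (X Y Z : C) (g : hom Y Z) (f : hom X Y) :
  cle (Ker F f) (Ker F (g ∘ f)).
Proof. by rewrite Ker_comp; apply: inverse_mono; exact: ge_bot. Qed.

Lemma insideE (W X : C) (S : cluster F X) (w : hom W X) :
  inside S w <-> cle (Im F w) S.
Proof. exact: iff_sym (direct_cgeq _ _ _). Qed.

Lemma inside_Im (W X : C) (w : hom W X) : inside (Im F w) w.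
Proof. by apply/insideE; exact: cle_refl. Qed.

Lemma inside_le (W X : C) (S T : cluster F X) (w : hom W X) :
  cle S T -> inside S w -> inside T w.
Proof. by move=> ST /insideE wS; apply/insideE; apply: cle_trans ST. Qed.

Lemma inside_comp (V W X : C) (S : cluster F X) (w : hom W X) (v : hom V W) :
  inside S w -> inside S (w ∘ v).
Proof. by move=> h; apply: (cgeq_comp h); apply/direct_cgeq; exact: le_top. Qed.

Lemma inside_Im_comp (V W X : C) (w : hom W X) (v : hom V W) :
  inside (Im F w) (w ∘ v).
Proof. exact: inside_comp (inside_Im w). Qed.

Lemma inside_inverse (W X Y : C) (f : hom X Y) (T : cluster F Y) (w : hom W X) :
  inside (inverse f T) w <-> inside T (f ∘ w).
Proof. exact: iff_sym (cgeq_factors _ _ _ _). Qed.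

Lemma inside_meet (W X : C) (S T : cluster F X) (w : hom W X) :
  inside (fmeet S T) w <-> inside S w /\ inside T w.
Proof.
by rewrite !insideE; exact: le_meet.
Qed.

Lemma inside_top (W X : C) (w : hom W X) : inside (ftop F X) w.
Proof. by apply/insideE; exact: le_top. Qed.

Lemma split_epi_Im (X Y : C) (p : hom X Y) (s : hom Y X) :
  p ∘ s = idm Y -> Im F p = ftop F Y.
Proof.
by move=> ps; apply: top_le; rewrite -Im_id -ps; apply/insideE; exact: inside_Im_comp.
Qed.

Lemma split_mono_Ker (X Y : C) (s : hom X Y) (p : hom Y X) :
  p ∘ s = idm X -> Ker F s = fbot F X.
Proof. by move=> ps; apply: le_bot; rewrite -Ker_id -ps; exact: Ker_le_comp. Qed.

End Orean.
End FormCalculus.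

(** * Zero morphisms, products and equalizers *)


Section CategoryTools.
Local Open Scope cat_scope.
Variable C : category.

Definition monic (X Y : C) (m : hom X Y) : Prop :=
  forall (W : C) (a b : hom W X), m ∘ a = m ∘ b -> a = b.

Definition factors_through (W M X : C) (w : hom W X) (m : hom M X) : Prop :=
  exists g : hom W M, w = m ∘ g.

Lemma monic_comp (X Y Z : C) (f : hom X Y) (g : hom Y Z) :
  monic f -> monic g -> monic (g ∘ f).
Proof. by move=> mf mg W a b; rewrite -!comp_assoc => /mg/mf. Qed.

Lemma split_monic (X Y : C) (s : hom X Y) (p : hom Y X) : p ∘ s = idm X -> monic s.
Proof. by move=> ps W a b e; rewrite -(comp_idl a) -(comp_idl b) -ps -!comp_assoc e. Qed.

Lemma id_factors_iso (X Y : C) (m : hom X Y) :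
  monic m -> factors_through (idm Y) m -> is_iso m.
Proof.
move=> mm [g e]; exists g; split=> //.
by apply: mm; rewrite comp_assoc -e comp_idl comp_idr.
Qed.

Lemma pullback_factor (P X Y Z W : C) (p1 : hom P X) (p2 : hom P Y)
    (f : hom X Z) (g : hom Y Z) (w1 : hom W X) (w2 : hom W Y) :
  is_pullback p1 p2 f g -> f ∘ w1 = g ∘ w2 ->
  exists u : hom W P, p1 ∘ u = w1 /\ p2 ∘ u = w2.
Proof. by move=> [_ h] /h [u [e _]]; exists u. Qed.

Lemma pullback_eq (P X Y Z W : C) (p1 : hom P X) (p2 : hom P Y)
    (f : hom X Z) (g : hom Y Z) (u v : hom W P) :
  is_pullback p1 p2 f g -> p1 ∘ u = p1 ∘ v -> p2 ∘ u = p2 ∘ v -> u = v.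
Proof.
move=> [c h] e1 e2.
have [|t [_ ut]] := h W (p1 ∘ v) (p2 ∘ v); first by rewrite !comp_assoc c.
by rewrite -(ut u) // -(ut v).
Qed.

Lemma pullbackP (P X Y Z : C) (p1 : hom P X) (p2 : hom P Y) (f : hom X Z)
    (g : hom Y Z) :
  f ∘ p1 = g ∘ p2 ->
  (forall W (w1 : hom W X) (w2 : hom W Y), f ∘ w1 = g ∘ w2 ->
     exists u : hom W P, p1 ∘ u = w1 /\ p2 ∘ u = w2) ->
  (forall W (u v : hom W P), p1 ∘ u = p1 ∘ v -> p2 ∘ u = p2 ∘ v -> u = v) ->
  is_pullback p1 p2 f g.
Proof.
move=> c ex un; split=> // W w1 w2 /ex [u [u1 u2]].
by exists u; split=> // v [v1 v2]; apply: un; congruence.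
Qed.

Lemma pullback_monic (P X Y Z : C) (p1 : hom P X) (p2 : hom P Y) (f : hom X Z)
    (g : hom Y Z) :
  is_pullback p1 p2 f g -> monic g -> monic p1.
Proof.
move=> pb mg W a b e; apply: (pullback_eq pb) => //.
by apply: mg; rewrite !comp_assoc -pb.1 -!comp_assoc e.
Qed.

Lemma coequalizer_epi (X Y Q : C) (f g : hom X Y) (q : hom Y Q) :
  is_coequalizer f g q ->
  forall (W : C) (a b : hom Q W), a ∘ q = b ∘ q -> a = b.
Proof.
move=> [c h] W a b e.
have [|t [_ ut]] := h W (b ∘ q); first by rewrite -!comp_assoc c.
by rewrite -(ut a) // -(ut b).
Qed.

Lemma regular_epi_epi (Y Q : C) (q : hom Y Q) : is_regular_epi q ->
  forall (W : C) (a b : hom Q W), a ∘ q = b ∘ q -> a = b.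
Proof. by move=> [X [f [g h]]]; exact: coequalizer_epi h. Qed.

(** Zero morphisms are chosen data, so that [0] is a term. The field [zero_ob_id] makes [zero_ob]
    both initial and terminal: every morphism into or out of it is zero. *)
Record zero_family := ZeroFamily {
  zero : forall X Y : C, hom X Y;
  comp0r : forall (X Y Z : C) (g : hom Y Z), g ∘ zero X Y = zero X Z;
  comp0l : forall (X Y Z : C) (f : hom X Y), zero Y Z ∘ f = zero X Z;
  zero_ob : C;
  zero_ob_id : idm zero_ob = zero zero_ob zero_ob
}.

Lemma pointed_zero : pointed C -> inhabited zero_family.
Proof.
move=> [Z [hT hI]].
have eqT X (f g : hom X Z) : f = g.
  by have [t [_ ut]] := hT X; rewrite -(ut f) // -(ut g).
have eqI X (f g : hom Z X) : f = g.
  by have [t [_ ut]] := hI X; rewrite -(ut f) // -(ut g).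
have toZ X : hom X Z.
  by apply: (fun h => proj1_sig (constructive_indefinite_description (fun=> True) h));
     have [t [_ _]] := hT X; exists t.
have ofZ X : hom Z X.
  by apply: (fun h => proj1_sig (constructive_indefinite_description (fun=> True) h));
     have [t [_ _]] := hI X; exists t.
split; apply: (@ZeroFamily (fun X Y => ofZ Y ∘ toZ X) _ _ Z) => [X Y W g | X Y W f |].
- by rewrite comp_assoc; congr (_ ∘ _).
- by rewrite -comp_assoc; congr (_ ∘ _).
- exact: eqT.
Qed.

Lemma to_zero_ob (z : zero_family) (X : C) (f : hom X (zero_ob z)) :
  f = zero z X (zero_ob z).
Proof. by rewrite -(comp_idl f) zero_ob_id comp0l. Qed.

Lemma of_zero_ob (z : zero_family) (X : C) (f : hom (zero_ob z) X) :
  f = zero z (zero_ob z) X.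
Proof. by rewrite -(comp_idr f) zero_ob_id comp0r. Qed.

Record binary_products := BinaryProducts {
  bprod : C -> C -> C;
  bfst : forall X Y : C, hom (bprod X Y) X;
  bsnd : forall X Y : C, hom (bprod X Y) Y;
  bpair : forall W X Y : C, hom W X -> hom W Y -> hom W (bprod X Y);
  bfst_pair : forall (W X Y : C) (f : hom W X) (g : hom W Y),
    bfst X Y ∘ bpair f g = f;
  bsnd_pair : forall (W X Y : C) (f : hom W X) (g : hom W Y),
    bsnd X Y ∘ bpair f g = g;
  bpair_eq : forall (W X Y : C) (u v : hom W (bprod X Y)),
    bfst X Y ∘ u = bfst X Y ∘ v -> bsnd X Y ∘ u = bsnd X Y ∘ v -> u = v
}.

Lemma product_eq (I : Type) (X : I -> C) (P : C) (pr : forall i, hom P (X i))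
    (W : C) (u v : hom W P) :
  is_product pr -> (forall i, pr i ∘ u = pr i ∘ v) -> u = v.
Proof.
by move=> h e; have [t [_ ut]] := h W (fun i => pr i ∘ v); rewrite -(ut u) // -(ut v).
Qed.

Lemma finite_products_binary : has_finite_products C -> inhabited binary_products.
Proof.
move=> hp.
pose fam (X Y : C) := fun b : bool => if b then X else Y.
have bp (X Y : C) : {P : C & {pr : forall b, hom P (fam X Y b) | is_product pr}}.
  have [P hP] := constructive_indefinite_description _ (hp bool (fam X Y)).
  by exists P; apply: constructive_indefinite_description.
have lift X Y W (f : hom W X) (g : hom W Y) :
    {u : hom W (projT1 (bp X Y)) |
      sval (projT2 (bp X Y)) true ∘ u = f /\ sval (projT2 (bp X Y)) false ∘ u = g}.
  apply: constructive_indefinite_description; case: (bp X Y) => P [pr /= h].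
  have [u [hu _]] := h W (fun b => if b return hom W (fam X Y b) then f else g).
  by exists u; split; [exact: (hu true) | exact: (hu false)].
split; exists (fun X Y => projT1 (bp X Y)) (fun X Y => sval (projT2 (bp X Y)) true)
  (fun X Y => sval (projT2 (bp X Y)) false) (fun W X Y f g => sval (lift X Y W f g)).
- by move=> W X Y f g; case: (lift _ _ _ _ _) => u [].
- by move=> W X Y f g; case: (lift _ _ _ _ _) => u [].
- move=> W X Y u v; case: (bp X Y) u v => P [pr /= h] u v e1 e2.
  by apply: (product_eq h) => -[].
Qed.

Lemma finite_coproducts_binary : has_finite_coproducts C ->
  forall X Y : C, exists (S : C) (i : hom X S) (j : hom Y S),
    (forall W (f : hom X W) (g : hom Y W), exists u, u ∘ i = f /\ u ∘ j = g) /\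
    (forall W (u v : hom S W), u ∘ i = v ∘ i -> u ∘ j = v ∘ j -> u = v).
Proof.
move=> hc X Y; pose fam := fun b : bool => if b then X else Y.
have [S [inj h]] := hc bool fam; exists S, (inj true), (inj false); split.
  move=> W f g; have [u [hu _]] := h W (fun b => if b return hom (fam b) W then f else g).
  by exists u; split; [exact: (hu true) | exact: (hu false)].
move=> W u v e1 e2; have [t [_ ut]] := h W (fun b => v ∘ inj b).
by rewrite -(ut u) ?(ut v) // => -[].
Qed.

Lemma comp_pair (bp : binary_products) (V W X Y : C) (f : hom W X) (g : hom W Y)
    (v : hom V W) :
  bpair bp f g ∘ v = bpair bp (f ∘ v) (g ∘ v).
Proof.
by apply: bpair_eq; rewrite comp_assoc ?bfst_pair ?bsnd_pair // ?bfst_pair ?bsnd_pair.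
Qed.

(** * Finite limits from products and equalizers *)

Definition has_equalizers : Prop :=
  forall (X Y : C) (f g : hom X Y), exists (E : C) (e : hom E X),
    [/\ monic e, f ∘ e = g ∘ e
      & forall W (w : hom W X), f ∘ w = g ∘ w -> factors_through w e].

(** The limit is the equalizer of two morphisms from the product over objects to the product over
    arrows, both indexed by the given finite enumerations. *)
Lemma finite_limits_of_equalizers :
  has_finite_products C -> has_equalizers -> has_finite_limits C.
Proof.
move=> hp he J D [[I [o oS]] fin_hom].
have hom_enum i j :
    {A : finType & {a : A -> hom (o i) (o j) | forall b, exists x, a x = b}}.
  have [A hA] := constructive_indefinite_description _ (fin_hom (o i) (o j)).
  by exists A; apply: constructive_indefinite_description.
have [P [pr prP]] := hp I (fun i => D (o i)).
pose K := {ij : I * I & projT1 (hom_enum ij.1 ij.2)}.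
pose arrow (k : K) : hom (o (tag k).1) (o (tag k).2) :=
  sval (projT2 (hom_enum _ _)) (tagged k).
have [Q [qr qrP]] := hp K (fun k => D (o (tag k).2)).
have [s [hs _]] := qrP P (fun k => fmap D (arrow k) ∘ pr (tag k).1).
have [t [ht _]] := qrP P (fun k => pr (tag k).2).
have [L [l [ml el lE]]] := he _ _ s t.
have natural i j (a : hom (o i) (o j)) : fmap D a ∘ (pr i ∘ l) = pr j ∘ l.
  have [x xa] := svalP (projT2 (hom_enum i j)) a.
  pose k : K := Tagged (fun ij => projT1 (hom_enum ij.1 ij.2))
    (x : projT1 (hom_enum (i, j).1 (i, j).2)).
  have ak : arrow k = a by exact: xa.
  have hsk : qr k ∘ s = fmap D a ∘ pr i by rewrite -ak; exact: hs k.
  have htk : qr k ∘ t = pr j by exact: ht k.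
  by rewrite comp_assoc -hsk -htk -!comp_assoc el.
(* The enumeration [o] may repeat objects. Characterizing the leg at [j] by all arrows into [j]
   makes it independent of the index chosen for [j]. *)
have legs j : {leg : hom L (D j) |
    forall i (a : hom (o i) j), fmap D a ∘ (pr i ∘ l) = leg}.
  apply: constructive_indefinite_description; have [i ei] := oS j.
  by case: j / ei; exists (pr i ∘ l) => i' a; exact: natural.
have legE i : sval (legs (o i)) = pr i ∘ l.
  by rewrite -(svalP (legs (o i)) i (idm _)) fmap_id comp_idl.
exists L, (fun j => sval (legs j)); split.
  move=> i j a; have [i' ei] := oS i; case: i / ei a => a.
  by rewrite legE; exact: svalP (legs j) i' a.
move=> W w hw; have [p [hpw _]] := prP W (fun i => w (o i)).
have [|g eg] := lE W p.
  apply: (product_eq qrP) => k; rewrite !comp_assoc hs ht hpw -comp_assoc hpw.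
  exact: hw.
exists g; split=> [j | g' hg'].
  have [i ei] := oS j; case: j / ei.
  by rewrite legE -comp_assoc -eg hpw.
apply: ml; rewrite -eg; apply: (product_eq prP) => i.
by rewrite hpw -(hg' (o i)) legE comp_assoc.
Qed.

End CategoryTools.
Arguments zero {C} z {X Y}.
Arguments bfst {C} b {X Y}.
Arguments bsnd {C} b {X Y}.

(** * Noetherian forms and semi-abelian categories *)


Section NoetherianForms.
Local Open Scope cat_scope.
Variables (C : category) (F : orean_form C).

Lemma embedding_monic (X W : C) (S : cluster F X) (m : hom W X) :
  is_embedding S m -> monic m.
Proof.
move=> [<- h] V a b e; have [|t [_ ut]] := h V (m ∘ a).
  by apply/insideE; exact: inside_Im_comp.
by rewrite -(ut a) // -(ut b).
Qed.

Lemma embedding_inside (X W V : C) (S : cluster F X) (m : hom W X) (w : hom V X) :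
  is_embedding S m -> inside S w <-> factors_through w m.
Proof.
move=> [e h]; rewrite insideE; split=> [/h [g [eg _]] | [g ->]]; first by exists g.
by rewrite -insideE -e; exact: inside_Im_comp.
Qed.

Lemma embedding_top_iso (X W : C) (m : hom W X) :
  is_embedding (ftop F X) m -> is_iso m.
Proof.
move=> h; apply: id_factors_iso; first exact: embedding_monic h.
by apply/(embedding_inside _ h); exact: inside_top.
Qed.

(** Every kernel lies above bottom, so even the identity factors through [q]; uniqueness of the
    factorization of [q] makes this inverse two-sided. *)
Lemma quotient_bot_iso (X Y : C) (q : hom X Y) :
  is_quotient (fbot F X) q -> is_iso q.
Proof.
move=> [_ h]; have [r [er _]] := h X (idm X) (ge_bot _).
exists r; split=> //; have [t [_ ut]] := h Y q (ge_bot _).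
by rewrite -(ut (q ∘ r)) ?(ut (idm Y)) ?comp_idl // -comp_assoc -er comp_idr.
Qed.

Hypothesis noeth : noetherian F.

Lemma inverse_direct (X Y : C) (f : hom X Y) (S : cluster F X) :
  inverse f (direct f S) = fjoin S (Ker F f).
Proof. by case: noeth => h _ _ _; exact: (h X Y f).1. Qed.

Lemma noetherian_direct_inverse (X Y : C) (f : hom X Y) (T : cluster F Y) :
  direct f (inverse f T) = fmeet T (Im F f).
Proof. by case: noeth => h _ _ _; exact: (h X Y f).2. Qed.

Lemma noetherian_factor (X Y : C) (f : hom X Y) :
  exists (W : C) (e : hom X W) (m : hom W Y),
    [/\ f = m ∘ e, is_embedding (Im F f) m & is_quotient (Ker F f) e].
Proof. by case: noeth => _ h _ _; exact: h. Qed.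

Lemma conormal_embedding (X : C) (S : cluster F X) :
  conormal_cluster S -> exists (W : C) (m : hom W X), is_embedding S m.
Proof.
by move=> [V [f <-]]; have [W [e [m [_ h _]]]] := noetherian_factor f; exists W, m.
Qed.

(** The morphism whose image is [S] is the generic morphism inside [S], so testing on it
    suffices. *)
Lemma conormal_le (X : C) (S T : cluster F X) : conormal_cluster S ->
  (forall W (w : hom W X), inside S w -> inside T w) -> cle S T.
Proof. by move=> [V [f <-]] h; apply/insideE/h; exact: inside_Im. Qed.

(** In the factorization (N2) of [m] the quotient part is a quotient of bottom, hence invertible, so
    [m] is its embedding part up to isomorphism. [Im_top_quotient] is the dual. *)
Lemma Ker_bot_embedding (X Y : C) (m : hom X Y) :
  Ker F m = fbot F X -> is_embedding (Im F m) m.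
Proof.
move=> km; have [W [e [n [eq_m hn]]]] := noetherian_factor m.
rewrite km => /quotient_bot_iso [h [he eh]].
have me : n = m ∘ h by rewrite eq_m -comp_assoc eh comp_idr.
split=> // V w /insideE /(embedding_inside _ hn) [g ->].
exists (h ∘ g); split=> [|g']; first by rewrite comp_assoc me.
rewrite eq_m -comp_assoc => /(embedding_monic hn) ->.
by rewrite comp_assoc he comp_idl.
Qed.

Lemma Im_top_quotient (X Y : C) (q : hom X Y) :
  Im F q = ftop F Y -> is_quotient (Ker F q) q.
Proof.
move=> iq; have [W [e [m [eq_q hm he]]]] := noetherian_factor q.
have mono_m := embedding_monic hm.
move: hm; rewrite iq => /embedding_top_iso [h [hm mh]].
split=> // V w /he.2 [g [-> ug]].
exists (g ∘ h); split=> [|g' eg'].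
  by rewrite eq_q -comp_assoc (comp_assoc h) hm comp_idl.
rewrite (ug (g' ∘ m)); first by rewrite -comp_assoc mh comp_idr.
by rewrite eg' eq_q comp_assoc.
Qed.

(** * Pointed categories with conormal bottoms and inverse images *)

Section Pointed.
Variable z : zero_family C.
Notation "0" := (zero z).

(* Reflects [0 -> Y] being split mono, hence an embedding of its image. *)
Lemma inside_bot (W Y : C) (w : hom W Y) :
  conormal_cluster (fbot F Y) -> inside (fbot F Y) w <-> w = 0.
Proof.
move=> [V [f ef]]; split; last first.
  by move=> ->; rewrite -ef -(comp0r z W f); exact: inside_Im_comp.
have le0 : Im F (@zero C z (zero_ob z) Y) = fbot F Y.
  apply: le_bot; apply/insideE.
  by rewrite -ef -(comp0r z _ f); exact: inside_Im_comp.
have ker0 : Ker F (@zero C z (zero_ob z) Y) = fbot F (zero_ob z).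
  by apply: (split_mono_Ker _ (p := 0)); rewrite comp0r zero_ob_id.
have := Ker_bot_embedding ker0; rewrite le0 => emb.
by move=> /(embedding_inside _ emb) [g ->]; rewrite comp0l.
Qed.

Hypothesis inverse_conormal : forall (X Y : C) (f : hom X Y) (T : cluster F Y),
  conormal_cluster T -> conormal_cluster (inverse f T).
Hypothesis bot_conormal : forall X : C, conormal_cluster (fbot F X).

Lemma inside_Ker (W X Y : C) (f : hom X Y) (w : hom W X) :
  inside (Ker F f) w <-> f ∘ w = 0.
Proof. by rewrite inside_inverse inside_bot. Qed.

(** A kernel is the inverse image of a conormal bottom cluster, hence conormal, so it is determined
    by the morphisms inside it, those that [f] kills. *)
Lemma Ker_le (X Y : C) (f : hom X Y) (S : cluster F X) :
  (forall W (w : hom W X), f ∘ w = 0 -> inside S w) -> cle (Ker F f) S.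
Proof.
move=> h; apply: conormal_le => [|W w /inside_Ker]; last exact: h.
exact: inverse_conormal.
Qed.

Lemma monic_Ker (X Y : C) (m : hom X Y) : monic m -> Ker F m = fbot F X.
Proof.
move=> mm; apply: le_bot; apply: Ker_le => W w; rewrite -(comp0r z W m) => /mm ->.
exact/inside_bot.
Qed.

Lemma Ker_bot_monic (X Y : C) (m : hom X Y) :
  (forall W (w : hom W X), m ∘ w = 0 -> w = 0) -> monic m.
Proof.
move=> h; apply: (embedding_monic (Ker_bot_embedding _)).
by apply: le_bot; apply: Ker_le => W w /h ->; exact/inside_bot.
Qed.

Lemma monic_embedding (X Y : C) (m : hom X Y) : monic m -> is_embedding (Im F m) m.
Proof. by move/monic_Ker/Ker_bot_embedding. Qed.

Lemma inside_monic (W X Y : C) (m : hom X Y) (w : hom W Y) :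
  monic m -> inside (Im F m) w <-> factors_through w m.
Proof. by move/monic_embedding/embedding_inside. Qed.

Lemma monic_top_iso (X Y : C) (m : hom X Y) :
  monic m -> Im F m = ftop F Y -> is_iso m.
Proof. by move=> /monic_embedding h e; rewrite e in h; exact: embedding_top_iso h. Qed.

Lemma monic_factor (X Y : C) (f : hom X Y) :
  exists (W : C) (e : hom X W) (m : hom W Y),
    [/\ f = m ∘ e, monic m & Im F e = ftop F W].
Proof.
have [W [e [m [ef hm _]]]] := noetherian_factor f.
have mm := embedding_monic hm; exists W, e, m; split=> //.
(* As [Ker m] is bottom, (N1) makes [direct m] injective, so it suffices to compare the images along
   [m]. *)
have : direct m (Im F e) = direct m (ftop F W) by rewrite -Im_comp -ef -hm.1.
by move=> /(congr1 (inverse m)); rewrite !inverse_direct (monic_Ker mm) !join_bot.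
Qed.

Lemma Im_top_cokernel (X Y W : C) (q : hom X Y) (w : hom X W) :
  Im F q = ftop F Y -> (forall V (v : hom V X), q ∘ v = 0 -> w ∘ v = 0) ->
  exists! h : hom Y W, h ∘ q = w.
Proof.
move=> /Im_top_quotient [_ h] qw.
have [|u [-> uu]] := h W w; first by apply: Ker_le => V v /qw /inside_Ker.
by exists u; split=> // u' /esym /uu.
Qed.

(** If [q] is a coequalizer, the quotient part of [q] coequalizes the same pair, so the embedding
    part is split epi and has full image. Conversely [q] is the coequalizer of its kernel and
    [0]. *)
Lemma regular_epiE (X Y : C) (q : hom X Y) : is_regular_epi q <-> Im F q = ftop F Y.
Proof.
split=> [[W [f [g [qfg h]]]] | iq].
  have [V [e [m [eq_q hm he]]]] := noetherian_factor q.
  have [|u [uq _]] := h V e.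
    by apply: (embedding_monic hm); rewrite !comp_assoc -eq_q.
  rewrite -hm.1; apply: (split_epi_Im _ (s := u)).
  have [t [_ ut]] := h Y q qfg.
  by rewrite -(ut (m ∘ u)) ?(ut (idm Y)) ?comp_idl // -comp_assoc uq.
have [K [k hk]] := conormal_embedding (inverse_conormal q (bot_conormal Y)).
have qk : q ∘ k = 0.
  by apply/inside_Ker/(embedding_inside _ hk); exists (idm K); rewrite comp_idr.
exists K, k, 0; split=> [|W w]; first by rewrite qk comp0r.
rewrite comp0r => wk; apply: Im_top_cokernel => // V v /inside_Ker.
by move=> /(embedding_inside _ hk) [g ->]; rewrite comp_assoc wk comp0l.
Qed.

Lemma monic_pullback (X Y M : C) (f : hom X Y) (m : hom M Y) : monic m ->
  exists (P : C) (n : hom P X), is_embedding (inverse f (Im F m)) n /\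
    forall W (w : hom W X), factors_through w n <-> factors_through (f ∘ w) m.
Proof.
move=> mm; have [|P [n hn]] := @conormal_embedding X (inverse f (Im F m)).
  by apply: inverse_conormal; exists M, m.
exists P, n; split=> // W w; rewrite -(embedding_inside w hn).
by rewrite inside_inverse inside_monic.
Qed.

Variable bp : binary_products C.

(** The equalizer is the pullback of the diagonal of [Y] along the pairing of [f] and [g]. *)
Lemma noetherian_equalizers : has_equalizers C.
Proof.
move=> X Y f g.
have md : monic (bpair bp (idm Y) (idm Y)).
  by apply: (split_monic (p := bfst bp)); rewrite bfst_pair.
have [E [e [he hE]]] := monic_pullback (bpair bp f g) md.
exists E, e; split; first exact: embedding_monic he.
  have [|h] := (hE E e).1; first by exists (idm E); rewrite comp_idr.
  rewrite !comp_pair !comp_idl => eh.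
  by rewrite -(bfst_pair bp (f ∘ e) (g ∘ e)) eh bfst_pair -{1}(bsnd_pair bp h h) -eh bsnd_pair.
move=> W w e_fg; apply/hE; exists (f ∘ w).
by rewrite !comp_pair !comp_idl e_fg.
Qed.

Lemma noetherian_pullbacks (X Y Z : C) (f : hom X Z) (g : hom Y Z) :
  exists (P : C) (p1 : hom P X) (p2 : hom P Y), is_pullback p1 p2 f g.
Proof.
have [E [e [me ee hE]]] := noetherian_equalizers (f ∘ bfst bp) (g ∘ bsnd bp).
exists E, (bfst bp ∘ e), (bsnd bp ∘ e); apply: pullbackP; first by rewrite !comp_assoc.
  move=> W w1 w2 ew.
  have [|u eu] := hE W (bpair bp w1 w2).
    by rewrite -!comp_assoc bfst_pair bsnd_pair.
  by exists u; rewrite -!comp_assoc -eu bfst_pair bsnd_pair.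
move=> W u v; rewrite -!comp_assoc => e1 e2; apply: me.
exact: bpair_eq.
Qed.

(** By (N1) the join of the first axis with the kernel of the first projection is the inverse image
    of top. That kernel consists of the morphisms factoring through the second axis. *)
Lemma axes_join (X Y : C) (S : cluster F (bprod bp X Y)) :
  inside S (bpair bp (idm X) 0) -> inside S (bpair bp 0 (idm Y)) ->
  S = ftop F (bprod bp X Y).
Proof.
move=> /insideE h1 h2; apply: top_le.
apply: (@cle_trans _ _ _ (fjoin (Im F (bpair bp (idm X) 0)) (Ker F (bfst bp)))).
  rewrite -inverse_direct -Im_comp bfst_pair Im_id.
  by apply/inverse_cgeq/direct_cgeq; exact: le_top.
apply/join_le; split=> //; apply: Ker_le => W w w0.
suff -> : w = bpair bp 0 (idm Y) ∘ (bsnd bp ∘ w) by exact: inside_comp.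
rewrite comp_pair comp_idl comp0l.
by apply: (bpair_eq); rewrite ?bfst_pair ?bsnd_pair.
Qed.

(* The pullback of [g] along [f] is the inverse image of the graph of [f] along
   [1 x g], and [1 x g] has full image by [axes_join]. *)
Lemma Im_top_stable (P X Y Z : C) (p1 : hom P X) (p2 : hom P Y) (f : hom X Z)
    (g : hom Y Z) :
  is_pullback p1 p2 f g -> Im F g = ftop F Z -> Im F p1 = ftop F X.
Proof.
move=> pb ig.
pose k := bpair bp (bfst bp) (g ∘ bsnd bp) : hom (bprod bp X Y) (bprod bp X Z).
have k_top : Im F k = ftop F _.
  apply: axes_join.
    suff -> : bpair bp (idm X) 0 = k ∘ bpair bp (idm X) 0 by exact: inside_Im_comp.
    by rewrite comp_pair -comp_assoc bfst_pair bsnd_pair comp0r.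
  (* As [g] has full image, the second axis has the same image as its composite with [g], and that
     composite factors through [k]. *)
  apply/insideE; rewrite /Im -ig -Im_comp; apply/insideE.
  suff -> : bpair bp 0 (idm Z) ∘ g = k ∘ bpair bp 0 (idm Y) by exact: inside_Im_comp.
  by rewrite !comp_pair -comp_assoc bfst_pair bsnd_pair comp0l comp_idr comp_idl.
pose graph := bpair bp (idm X) f; pose j := bpair bp p1 p2.
have m_graph : monic graph by apply: (split_monic (p := bfst bp)); rewrite bfst_pair.
have kj : k ∘ j = graph ∘ p1.
  by rewrite !comp_pair -comp_assoc bfst_pair bsnd_pair comp_idl pb.1.
(* A morphism [(x, y)] is inside this inverse image exactly when [f x = g y], that is, when it
   factors through the pullback. *)
have inv_graph : inverse k (Im F graph) = Im F j.
  apply: cle_anti; last first.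
    by apply/insideE/inside_inverse; rewrite kj; exact: inside_Im_comp.
  apply: conormal_le => [|W w /inside_inverse/inside_monic].
    by apply: inverse_conormal; exists X, graph.
  move=> /(_ m_graph) [h]; rewrite !comp_pair -comp_assoc comp_idl => e.
  have e1 : bfst bp ∘ w = h by move: (congr1 (fun t => bfst bp ∘ t) e); rewrite !bfst_pair.
  have e2 : g ∘ (bsnd bp ∘ w) = f ∘ h.
    by move: (congr1 (fun t => bsnd bp ∘ t) e); rewrite !bsnd_pair.
  have [u [u1 u2]] := pullback_factor pb (esym e2).
  suff -> : w = j ∘ u by exact: inside_Im_comp.
  by rewrite comp_pair; apply: (bpair_eq); rewrite ?bfst_pair ?bsnd_pair ?u1 ?u2.
have : direct graph (Im F p1) = Im F graph.
  rewrite -Im_comp -kj Im_comp -inv_graph noetherian_direct_inverse k_top.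
  by rewrite meet_top.
by move=> /(congr1 (inverse graph)); rewrite !inverse_direct (monic_Ker m_graph) !join_bot.
Qed.

Lemma noetherian_regular : has_finite_products C -> regular_category C.
Proof.
move=> hp; split; first exact: finite_limits_of_equalizers noetherian_equalizers.
- move=> R X Y r1 r2 f pb; have [W [e [m [eq_f hm he]]]] := noetherian_factor f.
  exists W, e; split.
    by apply: (embedding_monic hm); rewrite !comp_assoc -eq_f pb.1.
  move=> V w ew; have [|h [eh uh]] := he.2 V w.
    (* If [f] kills [u], the pair [(u, 0)] factors through the kernel pair, so [w] kills [u] too. *)
    apply: Ker_le => U u fu; apply/inside_Ker.
    have [|t [t1 t2]] := @pullback_factor _ _ _ _ _ _ _ _ _ _ u 0 pb.
      by rewrite fu comp0r.
    by rewrite -t1 comp_assoc ew -comp_assoc t2 comp0r.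
  by exists h; split=> // h' /esym/uh.
- move=> P X Y Z p1 p2 f g pb /regular_epiE ig; apply/regular_epiE.
  exact: Im_top_stable pb ig.
Qed.

(* The direct image of [Ker h] is [Ker h'], where [h'] is the factorization
   through [e] of a morphism with kernel [Ker h \/ Ker e]. *)
Lemma direct_normal (X Y : C) (e : hom X Y) (S : cluster F X) :
  Im F e = ftop F Y -> normal_cluster S -> normal_cluster (direct e S).
Proof.
move=> ie nS; have nK : normal_cluster (Ker F e) by exists Y, e.
have [_ _ nj _] := noeth; have [W [h eh]] := nj _ _ _ nS nK.
have [|h' [eh' _]] := (Im_top_quotient ie).2 W h; first by rewrite eh; exact: le_joinr.
exists W, h'; rewrite -[LHS]meet_top -[RHS]meet_top -ie.
by rewrite -!noetherian_direct_inverse inverse_direct -Ker_comp -eh' eh.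
Qed.

(* A reflexive and symmetric relation is the kernel pair of any [q] whose kernel
   is the class of zero; [q r1 = q r2] because both have kernel
   [Ker r1 \/ Ker r2] and agree on the diagonal. *)
Lemma noetherian_effective (R X : C) (r1 r2 : hom R X) :
  is_equivalence_relation r1 r2 -> exists (Y : C) (f : hom X Y), is_kernel_pair r1 r2 f.
Proof.
move=> [jm [d [d1 d2]] [s [s1 s2]] _].
have i1 : Im F r1 = ftop F X by apply: split_epi_Im d1.
have i2 : Im F r2 = ftop F X by apply: split_epi_Im d2.
have ss : s ∘ s = idm R by apply: jm; rewrite comp_assoc ?s1 ?s2 comp_idr.
(* The involution [s] has full image and carries [Ker r1] onto [Ker r2], while [r2] is [r1] after
   [s]. *)
have N_swap : direct r1 (Ker F r2) = direct r2 (Ker F r1).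
  have is_ : Im F s = ftop F R by apply: split_epi_Im ss.
  rewrite -[in RHS]s1 direct_comp -s2 Ker_comp noetherian_direct_inverse.
  by rewrite is_ meet_top s2.
have nN : normal_cluster (direct r1 (Ker F r2)).
  by apply: direct_normal => //; exists X, r2.
have [V [f ef]] := nN; have [Y [q [m [eq_f mm iq]]]] := monic_factor f.
have kq : Ker F q = direct r1 (Ker F r2).
  by rewrite -ef eq_f Ker_comp (monic_Ker mm).
have q12 : q ∘ r1 = q ∘ r2.
  have [||u [eu _]] := @Im_top_cokernel R Y Y (q ∘ r1) (q ∘ r2).
  - by rewrite Im_comp i1.
  - move=> W w /inside_Ker; rewrite Ker_comp kq inverse_direct => kw.
    apply/inside_Ker; rewrite Ker_comp kq N_swap inverse_direct.
    apply: inside_le kw; apply/join_le; split; [exact: le_joinr | exact: le_joinl].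
  have qd : u ∘ q = q.
    have := congr1 (fun g => g ∘ d) eu.
    by rewrite -!comp_assoc d1 d2 comp_idr.
  by rewrite -eu comp_assoc qd.
exists Y, q; have [E [p1 [p2 pb]]] := noetherian_pullbacks q q.
have [t [t1 t2]] := pullback_factor pb q12.
have mt : monic t by move=> W a b e; apply: jm; rewrite -?t1 -?t2 -!comp_assoc e.
(* By (N1) the join of [Im t] and [Ker p1] is top, because [r1], the composite of [p1] and [t], has
   full image. An element [(0, x)] of [Ker p1] has [q x = 0], so [x] is the value under [r2] of an
   element of [Ker r1], and [(0, x)] is inside [Im t]. *)
have it : Im F t = ftop F E.
  have : inverse p1 (direct p1 (Im F t)) = ftop F E.
    rewrite -Im_comp t1 i1; apply: top_le; apply/inverse_cgeq/direct_cgeq.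
    exact: le_top.
  rewrite inverse_direct => <-; apply: cle_anti; first exact: le_joinl.
  apply/join_le; split; [exact: cle_refl | apply: Ker_le => W w w0].
  have [|L [l hl]] := @conormal_embedding R (Ker F r1).
    exact: inverse_conormal.
  have r1l : r1 ∘ l = 0.
    by apply/inside_Ker/(embedding_inside _ hl); exists (idm L); rewrite comp_idr.
  have ml : monic (r2 ∘ l).
    move=> U a b e; apply: (embedding_monic hl); apply: jm.
      by rewrite !comp_assoc r1l !comp0l.
    by rewrite !comp_assoc.
  have : inside (Im F (r2 ∘ l)) (p2 ∘ w).
    rewrite Im_comp hl.1 -N_swap -kq; apply/inside_Ker.
    by rewrite comp_assoc -pb.1 -comp_assoc w0 comp0r.
  move/(inside_monic _ ml) => [v ev].
  suff -> : w = t ∘ (l ∘ v) by exact: inside_Im_comp.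
  apply: (pullback_eq pb); first by rewrite w0 !comp_assoc t1 r1l comp0l.
  by rewrite ev !comp_assoc t2.
have [t' [_ tt']] := monic_top_iso mt it.
apply: pullbackP => // W w1 w2 /(pullback_factor pb) [u [u1 u2]].
by exists (t' ∘ u); rewrite -t1 -t2 -!comp_assoc !(comp_assoc t) tt' comp_idl.
Qed.

(** Split short five lemma. Morphisms killed by the projections of [P] and [P'] lift to [Q] and
    [Q'], where [k] is invertible. Hence [Ker h] is bottom, and [Im h] contains [Ker (pt_proj P')];
    as [Im h] also maps onto the base, it is top by (N1). *)
Lemma noetherian_protomodular : protomodular C.
Proof.
split=> [E B f P | E B f P P' Q Q' u u' [h [h1 h2]] [k [k1 k2]] [pb us] [pb' us'] /= uk].
  have [Q [p1 [p2 pb]]] := noetherian_pullbacks f (pt_proj P).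
  have [|s [s1 s2]] := @pullback_factor _ _ _ _ _ _ _ _ _ _ (idm E) (pt_sec P ∘ f) pb.
    by rewrite comp_assoc pt_split comp_idl comp_idr.
  by exists (Point s1), p2.
move=> [[k' kP'] [e1 e2]].
have {e1} k'k : k' ∘ k = idm _ by exact: (congr1 (fun a : point_hom Q Q => sval a) e1).
have {e2} kk' : k ∘ k' = idm _ by exact: (congr1 (fun a : point_hom Q' Q' => sval a) e2).
have lift W (w : hom W (pt_ob P)) : pt_proj P ∘ w = 0 ->
    exists v, pt_proj Q ∘ v = 0 /\ u ∘ v = w.
  by move=> w0; apply: (pullback_factor pb); rewrite w0 comp0r.
have lift' W (w : hom W (pt_ob P')) : pt_proj P' ∘ w = 0 ->
    exists v, pt_proj Q' ∘ v = 0 /\ u' ∘ v = w.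
  by move=> w0; apply: (pullback_factor pb'); rewrite w0 comp0r.
have mh : monic h.
  apply: Ker_bot_monic => W w w0.
  have [|v [v1 v2]] := lift W w; first by rewrite -h1 -comp_assoc w0 comp0r.
  suff kv : k ∘ v = 0 by rewrite -v2 -(comp_idl v) -k'k -(comp_assoc k') kv !comp0r.
  apply: (pullback_eq pb'); first by rewrite comp_assoc k1 v1 comp0r.
  by rewrite comp_assoc uk -comp_assoc v2 w0 comp0r.
have ih : Im F h = ftop F _.
  have : inverse (pt_proj P') (direct (pt_proj P') (Im F h)) = ftop F _.
    rewrite -Im_comp h1 (split_epi_Im _ (pt_split P)).
    by apply: top_le; apply/inverse_cgeq/direct_cgeq; exact: le_top.
  rewrite inverse_direct => <-; apply: cle_anti; first exact: le_joinl.
  apply/join_le; split; [exact: cle_refl | apply: Ker_le => W w /lift' [v [v1 v2]]].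
  suff -> : w = h ∘ (u ∘ (k' ∘ v)) by exact: inside_Im_comp.
  by rewrite comp_assoc -uk -comp_assoc (comp_assoc k) kk' comp_idl.
have [h' [hh' h'h]] := monic_top_iso mh ih.
have hP' : pt_proj P ∘ h' = pt_proj P' /\ h' ∘ pt_sec P' = pt_sec P.
  by rewrite -h1 -h2 -comp_assoc h'h comp_idr comp_assoc hh' comp_idl.
by exists (exist _ h' hP'); split; apply: point_hom_eq.
Qed.

End Pointed.
End NoetherianForms.

(** * Regular protomodular categories *)


Section Cospan.
Local Open Scope cat_scope.

(* [None] is the common codomain of the two arrows of the cospan. *)
Definition cospan_hom (i j : option bool) : Type :=
  match i, j with
  | _, None | Some true, Some true | Some false, Some false => unit
  | _, _ => void
  end.

Definition cospan_id (i : option bool) : cospan_hom i i :=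
  match i with None | Some true | Some false => tt end.

Definition cospan_comp (i j k : option bool) :
  cospan_hom j k -> cospan_hom i j -> cospan_hom i k.
Proof. by case: i j k => [[]|] [[]|] [[]|]. Defined.

Definition cospan : category.
Proof.
by apply: (@Category _ cospan_hom cospan_id cospan_comp) => /=;
  repeat case=> //; repeat case=> //.
Defined.

Lemma cospan_finite : finite_category cospan.
Proof.
split; first by exists (option bool), id => x; exists x.
by case=> [[]|] [[]|]; (exists unit, id + exists void, id) => x; exists x.
Qed.

Variables (C : category) (X Y Z : C) (f : hom X Z) (g : hom Y Z).

Definition cospan_ob (i : option bool) : C :=
  match i with None => Z | Some true => X | Some false => Y end.

Definition cospan_map (i j : option bool) :
  cospan_hom i j -> hom (cospan_ob i) (cospan_ob j) :=
  match i, j return cospan_hom i j -> hom (cospan_ob i) (cospan_ob j) with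
  | None, None => fun=> idm Z
  | Some true, None => fun=> f
  | Some false, None => fun=> g
  | Some true, Some true => fun=> idm X
  | Some false, Some false => fun=> idm Y
  | _, _ => fun v : void => match v with end
  end.

Lemma cospan_map_comp (i j k : option bool) (b : cospan_hom j k) (a : cospan_hom i j) :
  cospan_map (cospan_comp b a) = cospan_map b ∘ cospan_map a.
Proof.
by move: i j k a b => [[]|] [[]|] [[]|] [] [] /=; rewrite ?comp_idl ?comp_idr.
Qed.

Definition cospan_diagram : functor cospan C :=
  @Functor cospan C cospan_ob cospan_map
    (fun i => match i with None | Some true | Some false => erefl end)
    cospan_map_comp.

Lemma pullback_exists : has_finite_limits C ->
  exists (P : C) (p1 : hom P X) (p2 : hom P Y), is_pullback p1 p2 f g.
Proof.
move=> fl; have [L [pr [nat_pr lim]]] := fl _ cospan_diagram cospan_finite.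
have prX : f ∘ pr (Some true) = pr None := nat_pr (Some true) None tt.
have prY : g ∘ pr (Some false) = pr None := nat_pr (Some false) None tt.
exists L, (pr (Some true)), (pr (Some false)); split; first by rewrite prX prY.
move=> W w1 w2 e.
pose w (i : option bool) : hom W (cospan_ob i) :=
  match i with None => f ∘ w1 | Some true => w1 | Some false => w2 end.
have [|u [hu uu]] := lim W w.
  by move=> [[]|] [[]|] [] //=; rewrite ?comp_idl.
exists u; split; first by split; [exact: (hu (Some true)) | exact: (hu (Some false))].
move=> u' [e1 e2]; apply: uu => -[[]|] //=; rewrite -?e1 -?e2 //.
by rewrite -prX comp_assoc.
Qed.

End Cospan.

(** * Kernels, relations and quotients in pointed protomodular categories *)

Section ProtomodularCategories.
Local Open Scope cat_scope.
Variables (C : category) (z : zero_family C).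
Notation "0" := (zero z).
Hypothesis proto : protomodular C.

(* A split epimorphism [p] with section [s]: no proper subobject contains both
   [s] and the kernel of [p]. *)
Lemma split_monic_iso (A B M : C) (p : hom A B) (s : hom B A) (n : hom M A) :
  p ∘ s = idm B -> monic n -> factors_through s n ->
  (forall W (w : hom W A), p ∘ w = 0 -> factors_through w n) -> is_iso n.
Proof.
move=> ps mn [s' ss'] kn.
have ps' : (p ∘ n) ∘ s' = idm B by rewrite -comp_assoc -ss'.
pose P : points B := Point ps'; pose P' : points B := Point ps.
(* Change of base along [0] takes kernels of points. The morphism [n] induces an isomorphism [k] of
   kernels, so conservativity applies. *)
pose f : hom (zero_ob z) B := 0.
have [Q [u cb]] := proto.1 _ _ f P; have [pb us] := cb.
have [Q' [u' cb']] := proto.1 _ _ f P'; have [pb' us'] := cb'.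
have [|k [k1 k2]] := @pullback_factor _ _ _ _ _ _ _ _ _ _ (pt_proj Q) (n ∘ u) pb'.
  by rewrite pb.1 comp_assoc.
have [|v ev] := kn _ u'; first by rewrite -[p ∘ u']pb'.1 comp0l.
have [|k' [k1' k2']] := @pullback_factor _ _ _ _ _ _ _ _ _ _ (pt_proj Q') v pb.
  by rewrite pb'.1 ev comp_assoc.
have hk : pt_proj Q' ∘ k = pt_proj Q /\ k ∘ pt_sec Q = pt_sec Q'.
  by split=> //; rewrite [LHS]of_zero_ob [RHS]of_zero_ob.
have hk' : pt_proj Q ∘ k' = pt_proj Q' /\ k' ∘ pt_sec Q' = pt_sec Q.
  by split=> //; rewrite [LHS]of_zero_ob [RHS]of_zero_ob.
have hn : pt_proj P' ∘ n = pt_proj P /\ n ∘ pt_sec P = pt_sec P' by split.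
have [||h [h1 h2]] := proto.2 _ _ f P P' (Q : points _) (Q' : points _) u u'
  (exist _ n hn) (exist _ k hk) cb cb'.
- by rewrite /= k2.
- exists (exist _ k' hk'); split; apply: point_hom_eq => /=.
    apply: (pullback_eq pb); rewrite comp_assoc comp_idr ?k1' ?k2' //.
    by apply: mn; rewrite comp_assoc -ev k2.
  apply: (pullback_eq pb'); rewrite comp_assoc comp_idr ?k1 ?k2 //.
  by rewrite -comp_assoc k2' ev.
exists (sval h); split.
  exact: (congr1 (fun a : point_hom P P => sval a) h1).
exact: (congr1 (fun a : point_hom P' P' => sval a) h2).
Qed.

Hypothesis reg : regular_category C.

Lemma regular_pullback (X Y Z : C) (f : hom X Z) (g : hom Y Z) :
  exists (P : C) (p1 : hom P X) (p2 : hom P Y), is_pullback p1 p2 f g.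
Proof. by case: reg => fl _ _; exact: pullback_exists. Qed.

(** The first projection of the kernel pair of [m] is split by the diagonal [d] and has zero kernel,
    so [d] is invertible and the two projections coincide. *)
Lemma Ker_monic (X Y : C) (m : hom X Y) :
  (forall W (w : hom W X), m ∘ w = 0 -> w = 0) -> monic m.
Proof.
move=> km; have [E [p1 [p2 pb]]] := regular_pullback m m.
have [d [d1 d2]] := pullback_factor pb (erefl (m ∘ idm X)).
have [|||d' [_ dd']] := @split_monic_iso _ _ _ p1 d d d1.
- exact: split_monic d1.
- by exists (idm X); rewrite comp_idr.
- move=> W w w0; exists 0; rewrite comp0r; apply: (pullback_eq pb); rewrite ?comp0r //.
  by apply: km; rewrite comp_assoc -pb.1 -comp_assoc w0 comp0r.
have p12 : p1 = p2.
  by rewrite -(comp_idr p1) -(comp_idr p2) -dd' !comp_assoc d1 d2.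
move=> W a b /(pullback_factor pb) [u [<- <-]].
by rewrite p12.
Qed.

Lemma regular_epi_lift (X Y : C) (e : hom X Y) (W : C) (w : hom W Y) :
  is_regular_epi e -> exists (V : C) (c : hom V W) (v : hom V X),
    is_regular_epi c /\ e ∘ v = w ∘ c.
Proof.
move=> re; have [P [c [v pb]]] := regular_pullback w e.
by exists P, c, v; split; [case: reg => _ _ st; exact: st pb re | rewrite pb.1].
Qed.

(** The regular epimorphism is the coequalizer [q] of the kernel pair of [f]. An element killed by
    [m] lifts to [X] after a regular epimorphism; there [f] kills it, so [q] identifies it with
    zero. *)
Lemma regular_factor (X Y : C) (f : hom X Y) :
  exists (I : C) (e : hom X I) (m : hom I Y),
    [/\ f = m ∘ e, monic m & is_regular_epi e].
Proof.
have [R [r1 [r2 pb]]] := regular_pullback f f.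
have [Q [q hq]] : exists (Q : C) (q : hom X Q), is_coequalizer r1 r2 q.
  by case: reg => _ ck _; exact: ck pb.
have rq : is_regular_epi q by exists R, r1, r2.
have [m [em _]] := hq.2 _ f pb.1.
exists Q, q, m; split=> //; apply: Ker_monic => W w mw.
have [V [c [v [rc qv]]]] := regular_epi_lift w rq.
have [|t [t1 t2]] := @pullback_factor _ _ _ _ _ _ _ _ _ _ v 0 pb.
  by rewrite comp0r -em -comp_assoc qv comp_assoc mw comp0l.
apply: (regular_epi_epi rc).
by rewrite -qv -t1 comp_assoc hq.1 -comp_assoc t2 comp0r comp0l.
Qed.

Lemma regular_epi_strong (X Y M Z : C) (e : hom X Y) (n : hom M Z) (h : hom Y Z) :
  is_regular_epi e -> monic n -> factors_through (h ∘ e) n -> factors_through h n.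
Proof.
move=> re mn [g eg]; have [W [a [b [eab he]]]] := re.
have [|u [ug _]] := he _ g.
  by apply: mn; rewrite !comp_assoc -eg -!comp_assoc eab.
by exists u; apply: (regular_epi_epi re); rewrite -comp_assoc ug.
Qed.

Lemma regular_epi_id (X : C) : is_regular_epi (idm X).
Proof.
exists X, (idm X), (idm X); split=> // W w _; exists w; split; first by rewrite comp_idr.
by move=> w' <-; rewrite comp_idr.
Qed.

Variable bp : binary_products C.

Lemma diagonal_monic (Y : C) : monic (bpair bp (idm Y) (idm Y)).
Proof. by apply: (split_monic (p := bfst bp)); rewrite bfst_pair. Qed.

(** The subobject of the kernel pair of [e] on which [q] takes equal values contains the diagonal
    and the kernel of the first projection, hence is everything by [split_monic_iso]. *)
Lemma kernel_pair_eq (X Y Z W : C) (e : hom X Y) (q : hom X Z) (a b : hom W X) :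
  (forall V (v : hom V X), e ∘ v = 0 -> q ∘ v = 0) ->
  e ∘ a = e ∘ b -> q ∘ a = q ∘ b.
Proof.
move=> kq; have [R [r1 [r2 pb]]] := regular_pullback e e.
have [d [d1 d2]] := pullback_factor pb (erefl (e ∘ idm X)).
have [N [n [n' pbn]]] :=
  regular_pullback (bpair bp (q ∘ r1) (q ∘ r2)) (bpair bp (idm Z) (idm Z)).
have inN V (w : hom V R) : q ∘ (r1 ∘ w) = q ∘ (r2 ∘ w) -> factors_through w n.
  move=> ew; have [|u [u1 _]] := @pullback_factor _ _ _ _ _ _ _ _ _ _ w (q ∘ (r1 ∘ w)) pbn.
    by rewrite !comp_pair !comp_idl -!comp_assoc -ew.
  by exists u.
have n12 : q ∘ r1 ∘ n = q ∘ r2 ∘ n.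
  have := pbn.1; rewrite !comp_pair comp_idl => en.
  rewrite -(bfst_pair bp (q ∘ r1 ∘ n) (q ∘ r2 ∘ n)) en.
  by rewrite bfst_pair -{1}(bsnd_pair bp n' n') -en bsnd_pair.
have [|||n1 [_ nn1]] := @split_monic_iso _ _ _ r1 d n d1.
- exact: pullback_monic pbn (@diagonal_monic Z).
- by apply: inN; rewrite d1 d2.
- move=> V w w0; apply: inN; rewrite w0 comp0r; apply: esym; apply: kq.
  by rewrite comp_assoc -pb.1 -comp_assoc w0 comp0r.
move=> /(pullback_factor pb) [t [<- <-]].
by rewrite -(comp_idl t) -nn1 -!comp_assoc !(comp_assoc r1) !(comp_assoc r2)
  !(comp_assoc q) !comp_assoc n12.
Qed.

(* The statement in elements: [x R y], [x' R y] and [x' R y'] imply [x R y'].  On the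
   object of all such quadruples, the relation [x R y'] contains the section
   [y' = y] of the projection forgetting [y'], and its kernel. *)
Lemma difunctional (R X W : C) (r1 r2 : hom R X) (u1 u2 u3 : hom W R) :
  (forall V (a b : hom V R), r1 ∘ a = r1 ∘ b -> r2 ∘ a = r2 ∘ b -> a = b) ->
  r2 ∘ u1 = r2 ∘ u2 -> r1 ∘ u2 = r1 ∘ u3 ->
  exists t : hom W R, r1 ∘ t = r1 ∘ u1 /\ r2 ∘ t = r2 ∘ u3.
Proof.
move=> jm e12 e23.
(* Here [A] collects [x R y] with [x' R y], [B] collects [x' R y] with [x' R y'], [P] glues them
   along [x' R y], and [D] is the part of [P] where [x R y']. *)
have [A [a1 [a2 pbA]]] := regular_pullback r2 r2.
have [B [b1 [b2 pbB]]] := regular_pullback r1 r1.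
have [P [p1 [p2 pbP]]] := regular_pullback a2 b1.
have [D [n [n' pbD]]] := regular_pullback
  (bpair bp (r1 ∘ (a1 ∘ p1)) (r2 ∘ (b2 ∘ p2))) (bpair bp r1 r2).
have mr : monic (bpair bp r1 r2).
  move=> V a b; rewrite !comp_pair => e; apply: jm.
    by rewrite -(bfst_pair bp (r1 ∘ a) (r2 ∘ a)) e bfst_pair.
  by rewrite -(bsnd_pair bp (r1 ∘ a) (r2 ∘ a)) e bsnd_pair.
have inD V (w : hom V P) (t : hom V R) : r1 ∘ (a1 ∘ p1 ∘ w) = r1 ∘ t ->
    r2 ∘ (b2 ∘ p2 ∘ w) = r2 ∘ t -> factors_through w n.
  move=> e1 e2; have [|u [eu _]] := @pullback_factor _ _ _ _ _ _ _ _ _ _ w t pbD.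
    by rewrite !comp_pair -e1 -e2 -!comp_assoc.
  by exists u.
have [d [d1 d2]] := pullback_factor pbB (erefl (r1 ∘ idm R)).
have [|s [s1 s2]] := @pullback_factor _ _ _ _ _ _ _ _ _ _ (idm A) (d ∘ a2) pbP.
  by rewrite comp_idr comp_assoc d1 comp_idl.
have [|||n1 [_ nn1]] := @split_monic_iso _ _ _ p1 s n s1.
- exact: pullback_monic pbD mr.
- apply: (inD _ _ a1); first by rewrite -comp_assoc s1 comp_idr.
  by rewrite -comp_assoc s2 (comp_assoc b2) d2 comp_idl pbA.1.
(* On the kernel of [p1] both [x] and [x'] vanish, so [x' R y'] already witnesses [x R y']. *)
- move=> V w w0; apply: (inD _ _ (b2 ∘ p2 ∘ w)) => //.
  rewrite -!comp_assoc w0 !comp0r (comp_assoc r1) -pbB.1 -comp_assoc.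
  by rewrite (comp_assoc b1) -pbP.1 -comp_assoc w0 !comp0r.
have [x [x1 x2]] := pullback_factor pbA e12.
have [y [y1 y2]] := pullback_factor pbB e23.
have [|w [w1 w2]] := @pullback_factor _ _ _ _ _ _ _ _ _ _ x y pbP; first by rewrite x2 y1.
exists (n' ∘ (n1 ∘ w)); have := congr1 (fun h => h ∘ (n1 ∘ w)) pbD.1.
rewrite -!comp_assoc (comp_assoc n) nn1 comp_idl !comp_pair => e.
move: e; rewrite -!comp_assoc w1 w2 x1 y2 => e; split.
  by rewrite -(bfst_pair bp (r1 ∘ u1) (r2 ∘ u3)) e bfst_pair.
by rewrite -(bsnd_pair bp (r1 ∘ u1) (r2 ∘ u3)) e bsnd_pair.
Qed.

(** Symmetry applies [difunctional] to [y R y], [x R y], [x R x]; transitivity to [x R y], [y R y],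
    [y R t]. *)
Lemma reflexive_relation_equivalence (R X : C) (r1 r2 : hom R X) (d : hom X R) :
  (forall V (a b : hom V R), r1 ∘ a = r1 ∘ b -> r2 ∘ a = r2 ∘ b -> a = b) ->
  r1 ∘ d = idm X -> r2 ∘ d = idm X -> is_equivalence_relation r1 r2.
Proof.
move=> jm d1 d2; split=> //; first by exists d.
  have [||s [s1 s2]] := @difunctional R X R r1 r2 (d ∘ r2) (idm R) (d ∘ r1) jm.
  - by rewrite comp_assoc d2 comp_idl comp_idr.
  - by rewrite comp_assoc d1 comp_idl comp_idr.
  by exists s; rewrite s1 s2 !comp_assoc d1 d2 !comp_idl.
move=> P p1 p2 pb.
have [||t ht] := @difunctional R X P r1 r2 p1 (d ∘ (r2 ∘ p1)) p2 jm; last by exists t.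
  by rewrite comp_assoc d2 comp_idl.
by rewrite comp_assoc d1 comp_idl pb.1.
Qed.

Hypothesis effective : forall (R X : C) (r1 r2 : hom R X),
  is_equivalence_relation r1 r2 -> exists (Y : C) (f : hom X Y), is_kernel_pair r1 r2 f.

(* The kernel of the quotient of [X] by the equivalence relation generated by a
   reflexive graph is the image under [b] of the kernel of [a]. *)
Lemma reflexive_graph_quotient (G X : C) (a b : hom G X) (d : hom X G) :
  a ∘ d = idm X -> b ∘ d = idm X ->
  exists (Q : C) (q : hom X Q), q ∘ a = q ∘ b /\
    forall W (w : hom W X), q ∘ w = 0 ->
      exists (V : C) (c : hom V W) (g : hom V G),
        [/\ is_regular_epi c, a ∘ g = 0 & b ∘ g = w ∘ c].
Proof.
move=> ad bd; have [R [e [m [em mm re]]]] := regular_factor (bpair bp a b).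
have ea : bfst bp ∘ m ∘ e = a by rewrite -comp_assoc -em bfst_pair.
have eb : bsnd bp ∘ m ∘ e = b by rewrite -comp_assoc -em bsnd_pair.
have [|||Y [h pb]] := effective
    (@reflexive_relation_equivalence R X (bfst bp ∘ m) (bsnd bp ∘ m) (e ∘ d) _ _ _).
- by move=> V u v; rewrite -!comp_assoc => e1 e2; apply: mm; exact: bpair_eq e1 e2.
- by rewrite comp_assoc ea.
- by rewrite comp_assoc eb.
exists Y, h; split; first by rewrite -ea -eb comp_assoc pb.1 -comp_assoc.
move=> W w w0; have [|u [u1 u2]] := @pullback_factor _ _ _ _ _ _ _ _ _ _ 0 w pb.
  by rewrite comp0r w0.
have [V [c [g [rc eg]]]] := regular_epi_lift u re.
exists V, c, g; split=> //.
  by rewrite -ea -comp_assoc eg comp_assoc u1 comp0l.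
by rewrite -eb -comp_assoc eg comp_assoc u2.
Qed.

End ProtomodularCategories.

(** * The form of subobjects *)


Section SubobjectForm.
Local Open Scope cat_scope.
Variable C : category.

(* A subobject is represented by the sieve of the morphisms that factor through
   it, which makes isomorphic monomorphisms equal. *)
Record subobject (X : C) := Subobject {
  mem : forall W : C, hom W X -> Prop;
  mem_monic : exists (M : C) (m : hom M X),
    monic m /\ forall W (w : hom W X), mem w <-> factors_through w m
}.

Lemma subobject_eq (X : C) (S T : subobject X) :
  (forall W (w : hom W X), mem S w <-> mem T w) -> S = T.
Proof.
case: S T => [P hP] [Q hQ] /= PQ.
have e : P = Q.
  apply: functional_extensionality_dep => W; apply: functional_extensionality => w.
  exact: propositional_extensionality.
by case: Q / e hQ {PQ} => hQ; congr Subobject; exact: proof_irrelevance.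
Qed.

Lemma mem_comp (X V W : C) (S : subobject X) (w : hom W X) (v : hom V W) :
  mem S w -> mem S (w ∘ v).
Proof.
case: (mem_monic S) => M [m [_ hm]] /hm [g ->]; apply/hm.
by exists (g ∘ v); rewrite comp_assoc.
Qed.

Definition subobject_map (A B : {X : C & subobject X}) : Type :=
  {f : hom (tag A) (tag B) |
    forall W (w : hom W (tag A)), mem (tagged A) w -> mem (tagged B) (f ∘ w)}.

Lemma subobject_map_eq (A B : {X : C & subobject X}) (f g : subobject_map A B) :
  sval f = sval g -> f = g.
Proof. by case: f g => f hf [g hg] /= e; apply: subset_eq_compat. Qed.

Definition subobject_id (A : {X : C & subobject X}) : subobject_map A A.
Proof. by exists (idm _) => W w; rewrite comp_idl. Defined.

Definition subobject_comp (A B D : {X : C & subobject X}) (g : subobject_map B D)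
    (f : subobject_map A B) : subobject_map A D.
Proof.
exists (sval g ∘ sval f) => W w h; rewrite -comp_assoc.
exact: (svalP g) (svalP f _ _ h).
Defined.

Definition subobject_category : category.
Proof.
apply: (@Category _ subobject_map subobject_id subobject_comp).
- by move=> A B f; apply: subobject_map_eq; rewrite /= comp_idl.
- by move=> A B f; apply: subobject_map_eq; rewrite /= comp_idr.
- by move=> A B D E h g f; apply: subobject_map_eq; rewrite /= comp_assoc.
Defined.

Definition subobject_functor : functor subobject_category C :=
  @Functor subobject_category C (fun A => tag A) (fun A B f => sval f)
    (fun=> erefl) (fun _ _ _ _ _ => erefl).

Lemma subobject_amnestic (A B : subobject_category) (h : hom A B) :
  is_iso h -> is_identity (fmap subobject_functor h) -> is_identity h.
Proof.
move=> [[g hg] [/(congr1 (fun k : subobject_map A A => sval k)) /= gh _]].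
case: A B h g hg gh => [X S] [Y T] [/= f hf] /= g hg gh i.
move: T hf g hg gh; case: Y f / i => T hf g hg /=; rewrite comp_idr => eg.
have e : S = T.
  apply: subobject_eq => W w; split=> [/hf | /hg] /=; first by rewrite comp_idl.
  by rewrite eg comp_idl.
case: T / e hf {hg} => hf.
pose A : {X : C & subobject X} := existT _ X S.
have -> : exist _ (idm X) hf = subobject_id A.
  exact: (@subobject_map_eq A A (exist _ (idm X) hf) (subobject_id A)).
exact: (@IsIdentity subobject_category).
Qed.

Definition subobject_form : form C :=
  @Form C subobject_category subobject_functor
    (fun A B => @subobject_map_eq A B) subobject_amnestic.

Definition cluster_of (X : C) (S : subobject X) : cluster subobject_form X :=
  exist (fun A : subobject_category => tag A = X) (existT _ X S) erefl.

Definition subobject_of (X : C) (S : cluster subobject_form X) : subobject X :=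
  match S with
  | exist A e => match e in _ = Y return subobject Y with erefl => tagged A end
  end.

Lemma subobject_cgeq (X Y : C) (f : hom X Y) (S : cluster subobject_form X)
    (T : cluster subobject_form Y) :
  cgeq f T S <->
  forall W (w : hom W X), mem (subobject_of S) w -> mem (subobject_of T) (f ∘ w).
Proof.
case: S T f => [[X' S] /= eX] [[Y' T] /= eY]; case: X / eX; case: Y / eY => f.
split=> [[h <-] W w | h]; first exact: svalP h W w.
by exists (exist _ f h).
Qed.

Lemma subobject_cle (X : C) (S T : cluster subobject_form X) :
  cle S T <-> forall W (w : hom W X), mem (subobject_of S) w -> mem (subobject_of T) w.
Proof.
by rewrite /cle subobject_cgeq; split=> h W w /h; rewrite comp_idl.
Qed.

(** * The orean structure on subobjects *)

Variable z : zero_family C.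
Notation "0" := (zero z).
Variable bp : binary_products C.
Hypothesis proto : protomodular C.
Hypothesis reg : regular_category C.
Hypothesis sums : has_finite_coproducts C.

(** Membership can be tested after a regular epimorphism. Direct images are defined up to such a
    cover, and this makes them least. *)
Lemma mem_local (X V W : C) (S : subobject X) (w : hom W X) (c : hom V W) :
  is_regular_epi c -> mem S (w ∘ c) -> mem S w.
Proof.
case: (mem_monic S) => M [m [mm hm]] rc /hm h; apply/hm.
exact: regular_epi_strong rc mm h.
Qed.

Definition subobject_bot (X : C) : subobject X.
Proof.
exists (fun W w => w = 0), (zero_ob z), 0; split.
  by move=> W a b _; rewrite (to_zero_ob a) (to_zero_ob b).
by move=> W w; split=> [-> | [g ->]]; [exists 0; rewrite comp0r | rewrite comp0l].
Defined.

Definition subobject_top (X : C) : subobject X.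
Proof.
exists (fun W w => True), X, (idm X); split=> [|W w]; first by move=> W a b; rewrite !comp_idl.
by split=> // _; exists w; rewrite comp_idl.
Defined.

Definition subobject_inverse (X Y : C) (f : hom X Y) (T : subobject Y) : subobject X.
Proof.
exists (fun W w => mem T (f ∘ w)).
case: (mem_monic T) => M [m [mm hm]].
have [P [p1 [p2 pb]]] := regular_pullback reg f m.
exists P, p1; split; first exact: pullback_monic pb mm.
move=> W w; rewrite hm; split=> [[g /(pullback_factor pb) [u [<- _]]] | [u ->]].
  by exists u.
by exists (p2 ∘ u); rewrite !comp_assoc pb.1.
Defined.

Definition subobject_meet (X : C) (S T : subobject X) : subobject X.
Proof.
exists (fun W w => mem S w /\ mem T w).
case: (mem_monic S) => M [m [mm hm]]; case: (mem_monic T) => N [n [mn hn]].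
have [P [p1 [p2 pb]]] := regular_pullback reg m n.
exists P, (m ∘ p1); split; first exact: monic_comp (pullback_monic pb mn) mm.
move=> W w; rewrite hm hn; split=> [[[a ->] [b /(pullback_factor pb) [u [<- _]]]] | [u ->]].
  by exists u; rewrite comp_assoc.
by rewrite -{1}comp_assoc pb.1; split; [exists (p1 ∘ u) | exists (p2 ∘ u)]; rewrite comp_assoc.
Defined.

Definition subobject_direct (X Y : C) (f : hom X Y) (S : subobject X) : subobject Y.
Proof.
exists (fun W w => exists (V : C) (c : hom V W) (v : hom V X),
  [/\ is_regular_epi c, mem S v & f ∘ v = w ∘ c]).
case: (mem_monic S) => M [m [mm hm]].
have [I [e [n [en mn re]]]] := regular_factor z proto reg (f ∘ m).
exists I, n; split=> // W w; split=> [[V [c [v [rc /hm [g ->] ev]]]] | [g ->]].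
  by apply: (regular_epi_strong rc mn); exists (e ∘ g); rewrite -ev !comp_assoc en.
have [V [c [v [rc ev]]]] := regular_epi_lift reg g re.
exists V, c, (m ∘ v); split=> //; first by apply/hm; exists v.
by rewrite comp_assoc en -!comp_assoc ev.
Defined.

(** Defined as the intersection of all upper bounds, so that the universal property is immediate; it
    is represented by the image of the coproduct of the two subobjects. *)
Definition subobject_join (X : C) (S T : subobject X) : subobject X.
Proof.
exists (fun W w => forall U : subobject X,
  (forall V (v : hom V X), mem S v -> mem U v) ->
  (forall V (v : hom V X), mem T v -> mem U v) -> mem U w).
case: (mem_monic S) => M [m [mm hm]]; case: (mem_monic T) => N [n [mn hn]].
have [P [i [j [cop cop_eq]]]] := finite_coproducts_binary sums M N.
have [t [ti tj]] := cop _ m n.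
have [I [e [k [ek mk re]]]] := regular_factor z proto reg t.
exists I, k; split=> // W w; split=> [h | [g ->] U SU TU].
  have sk : exists (M : C) (m : hom M X), monic m /\
      forall V (v : hom V X), factors_through v k <-> factors_through v m.
    by exists I, k.
  apply: (h (Subobject sk)) => V v /=.
    by move=> /hm [a ->]; exists (e ∘ i ∘ a); rewrite -ti ek !comp_assoc.
  by move=> /hn [a ->]; exists (e ∘ j ∘ a); rewrite -tj ek !comp_assoc.
apply: mem_comp; apply: (mem_local re); rewrite -ek.
case: (mem_monic U) => L [u [_ hu]].
have [|a ea] := (hu _ m).1; first by apply: SU; apply/hm; exists (idm M); rewrite comp_idr.
have [|b eb] := (hu _ n).1; first by apply: TU; apply/hn; exists (idm N); rewrite comp_idr.
have [r [ri rj]] := cop _ a b; apply/hu; exists r.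
by apply: cop_eq; rewrite -comp_assoc ?ti ?tj ?ri ?rj.
Defined.

Definition subobject_orean : orean subobject_form.
Proof.
apply: (@Orean C subobject_form (fun X => cluster_of (subobject_bot X))
  (fun X => cluster_of (subobject_top X))
  (fun X S T => cluster_of (subobject_join (subobject_of S) (subobject_of T)))
  (fun X S T => cluster_of (subobject_meet (subobject_of S) (subobject_of T)))
  (fun X Y f S => cluster_of (subobject_direct f (subobject_of S)))
  (fun X Y f T => cluster_of (subobject_inverse f (subobject_of T)))).
- move=> X S; apply/subobject_cle => W w /= ->.
  case: (mem_monic (subobject_of S)) => M [m [_ hm]].
  by apply/hm; exists 0; rewrite comp0r.
- by move=> X S; apply/subobject_cle.
- move=> X S T; split.
  + by apply/subobject_cle => W w Sw U SU _; exact: SU.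
  + by apply/subobject_cle => W w Tw U _ TU; exact: TU.
  + move=> U /subobject_cle SU /subobject_cle TU; apply/subobject_cle => W w; exact.
- move=> X S T; split.
  + by apply/subobject_cle => W w [].
  + by apply/subobject_cle => W w [].
  + by move=> U /subobject_cle US /subobject_cle UT; apply/subobject_cle => W w Uw;
      split; [exact: US | exact: UT].
- move=> X Y Z f g A D /subobject_cgeq h.
  exists (cluster_of (subobject_inverse g (subobject_of D))).
  by split; apply/subobject_cgeq => W w //= /h; rewrite comp_assoc.
- move=> X Y f S; split=> [|T /subobject_cgeq h].
    apply/subobject_cgeq => W w Sw; exists W, (idm W), w.
    by split; [exact: regular_epi_id | | rewrite comp_idr].
  apply/subobject_cle => W w [V [c [v [rc /h Tv e]]]].
  by apply: (mem_local rc); rewrite -e.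
- move=> X Y f T; split; first exact/subobject_cgeq.
  by move=> S /subobject_cgeq h; apply/subobject_cle => W w /h.
Defined.

Definition subobject_orean_form : orean_form C := OreanForm subobject_orean.
Notation F := subobject_orean_form.

Lemma subobject_inside (W X : C) (S : cluster F X) (w : hom W X) :
  inside S w <-> mem (subobject_of S) w.
Proof.
split=> [/subobject_cgeq/(_ W (idm W) I) | h]; first by rewrite comp_idr.
by apply/subobject_cgeq => V v _; exact: mem_comp.
Qed.

Lemma inside_cle (X : C) (S T : cluster F X) :
  cle S T <-> forall W (w : hom W X), inside S w -> inside T w.
Proof.
rewrite subobject_cle; split=> h W w; first by move=> /subobject_inside/h/subobject_inside.
by move/subobject_inside/h/subobject_inside.
Qed.

Lemma inside_monicP (X : C) (S : cluster F X) : exists (M : C) (m : hom M X),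
  monic m /\ forall W (w : hom W X), inside S w <-> factors_through w m.
Proof.
have [M [m [mm hm]]] := mem_monic (subobject_of S).
by exists M, m; split=> // W w; rewrite subobject_inside.
Qed.

Lemma inside_local (X V W : C) (S : cluster F X) (w : hom W X) (c : hom V W) :
  is_regular_epi c -> inside S (w ∘ c) -> inside S w.
Proof. by rewrite !subobject_inside; exact: mem_local. Qed.

Lemma inside_direct (X Y W : C) (f : hom X Y) (S : cluster F X) (w : hom W Y) :
  inside (direct f S) w <-> exists (V : C) (c : hom V W) (v : hom V X),
    [/\ is_regular_epi c, inside S v & f ∘ v = w ∘ c].
Proof.
rewrite subobject_inside; split=> -[V [c [v [rc hv e]]]]; exists V, c, v.
  by split=> //; apply/subobject_inside.
by split=> //; apply/subobject_inside.
Qed.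

Lemma inside_zero (X W : C) (w : hom W X) : inside (fbot F X) w <-> w = 0.
Proof. exact: subobject_inside. Qed.

Lemma inside_kernel (X Y W : C) (f : hom X Y) (w : hom W X) :
  inside (Ker F f) w <-> f ∘ w = 0.
Proof. by rewrite inside_inverse inside_zero. Qed.

Lemma inside_Im_monic (X Y W : C) (m : hom X Y) (w : hom W Y) : monic m ->
  inside (Im F m) w <-> factors_through w m.
Proof.
move=> mm; split=> [/inside_direct [V [c [v [rc _ e]]]] | [g ->]].
  by apply: (regular_epi_strong rc mm); exists v.
exact: inside_Im_comp.
Qed.

Lemma subobject_conormal : conormal_form F.
Proof.
move=> X S; have [M [m [mm hm]]] := inside_monicP S; exists M, m.
by apply: cle_anti; apply/inside_cle => W w; rewrite inside_Im_monic // hm.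
Qed.

(** The pullback [A] of [f] along the composite of [f] and [v] has a section given by [v]. Its part
    where [a2] lies in [J] contains this section and the kernel of [a1], hence is all of [A],
    including the point given by [v']. *)
Lemma inside_coset (X Y V : C) (f : hom X Y) (J : cluster F X) (v v' : hom V X) :
  (forall W (w : hom W X), f ∘ w = 0 -> inside J w) ->
  inside J v -> f ∘ v = f ∘ v' -> inside J v'.
Proof.
move=> kJ Jv e; have [A [a1 [a2 pbA]]] := regular_pullback reg (f ∘ v) f.
have [M [m [mm hm]]] := inside_monicP J.
have [N [n [n' pbN]]] := regular_pullback reg a2 m.
have inN W (w : hom W A) : inside J (a2 ∘ w) -> factors_through w n.
  by move=> /hm [g /(pullback_factor pbN) [u [<- _]]]; exists u.
have [|s [s1 s2]] := @pullback_factor _ _ _ _ _ _ _ _ _ _ (idm V) v pbA.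
  by rewrite comp_idr.
have [|||n1 [_ nn1]] := @split_monic_iso _ z proto _ _ _ a1 s n s1.
- exact: pullback_monic pbN mm.
- by apply: inN; rewrite s2.
- by move=> W w w0; apply/inN/kJ; rewrite comp_assoc -pbA.1 -comp_assoc w0 comp0r.
have [|t [_ <-]] := @pullback_factor _ _ _ _ _ _ _ _ _ _ (idm V) v' pbA.
  by rewrite comp_idr.
apply/hm; exists (n' ∘ (n1 ∘ t)).
by rewrite comp_assoc -pbN.1 -comp_assoc (comp_assoc n) nn1 comp_idl.
Qed.

(** If [e] coequalizes [a] and [b], so does every [q] with a larger kernel, by [kernel_pair_eq]. *)
Lemma regular_epi_quotient (X Y : C) (e : hom X Y) :
  is_regular_epi e -> is_quotient (Ker F e) e.
Proof.
move=> re; split=> // Y' q /inside_cle kq; have [W [a [b [eab he]]]] := re.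
have [|h [eh uh]] := he _ q.
  apply: (kernel_pair_eq proto reg bp _ eab) => V v e0.
  by apply/inside_kernel/kq/inside_kernel; exact: e0.
by exists h; split=> // h' /esym/uh.
Qed.

Hypothesis effective : forall (R X : C) (r1 r2 : hom R X),
  is_equivalence_relation r1 r2 -> exists (Y : C) (f : hom X Y), is_kernel_pair r1 r2 f.

(* [Ker f \/ Ker g] is the class of zero for the composite of the kernel pairs of
   [f] and [g], a reflexive graph on triples [x, y, y'] with [f x = f y] and
   [g y = g y']. *)
Lemma subobject_join_normal (X : C) (S T : cluster F X) :
  normal_cluster S -> normal_cluster T -> normal_cluster (fjoin S T).
Proof.
move=> [Y [f <-]] [Z [g <-]].
have [A [a1 [a2 pbA]]] := regular_pullback reg f f.
have [B [b1 [b2 pbB]]] := regular_pullback reg g g.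
have [G [p1 [p2 pbG]]] := regular_pullback reg a2 b1.
have tuple W (x y t : hom W X) : f ∘ x = f ∘ y -> g ∘ y = g ∘ t ->
    exists u : hom W G, [/\ a1 ∘ p1 ∘ u = x & b2 ∘ p2 ∘ u = t].
  move=> /(pullback_factor pbA) [u [u1 u2]] /(pullback_factor pbB) [v [v1 v2]].
  have [|r [r1 r2]] := @pullback_factor _ _ _ _ _ _ _ _ _ _ u v pbG.
    by rewrite u2 v1.
  by exists r; rewrite -!comp_assoc r1 r2.
have [d [d1 d2]] := tuple _ (idm X) (idm X) (idm X) erefl erefl.
have [Q [q [qab kq]]] := reflexive_graph_quotient z proto reg bp effective d1 d2.
have graph W (x y t : hom W X) : f ∘ x = f ∘ y -> g ∘ y = g ∘ t -> q ∘ x = q ∘ t.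
  move=> e1 e2; have [u [<- <-]] := tuple _ _ _ _ e1 e2.
  by rewrite (comp_assoc q (a1 ∘ p1)) qab -comp_assoc.
exists Q, q; apply: cle_anti; last first.
  apply/join_le; split; apply/inside_cle => W w /inside_kernel w0; apply/inside_kernel.
    by rewrite -(graph _ 0 w w) ?comp0r.
  by rewrite -(graph _ 0 0 w) ?comp0r.
apply/inside_cle => W w /inside_kernel /kq [V [c [u [rc u1 u2]]]].
apply: (inside_local rc); rewrite -u2.
(* The triple has the form [(0, y, t)]: its middle entry [y] lies in [Ker f], and [g y = g t] puts
   [t] in the coset of [y] modulo [Ker g]. *)
apply: (@inside_coset _ _ _ g _ (b1 ∘ p2 ∘ u)).
- by move=> U v v0; apply: (inside_le (le_joinr _ _)); apply/inside_kernel.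
- apply: (inside_le (le_joinl _ _)); apply/inside_kernel.
  rewrite -pbG.1 !comp_assoc -pbA.1 -!comp_assoc.
  by rewrite -!comp_assoc in u1; rewrite u1 comp0r.
by rewrite !comp_assoc pbB.1.
Qed.

Lemma subobject_noetherian : noetherian F.
Proof.
split.
- move=> X Y f; split=> [S | T]; apply: cle_anti.
  + apply/inside_cle => W w /inside_inverse/inside_direct [V [c [v [rc Sv e]]]].
    (* After the cover [c], the morphism [w] has the same value under [f] as [v], which is inside
       [S]. *)
    apply: (inside_local rc); apply: (@inside_coset _ _ _ f _ v).
    * by move=> U u u0; apply: (inside_le (le_joinr _ _)); apply/inside_kernel.
    * exact: (inside_le (le_joinl _ _)).
    * by rewrite e comp_assoc.
  + apply/join_le; split; first by apply/direct_inverse; exact: cle_refl.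
    by apply: inverse_mono; exact: ge_bot.
  + apply/le_meet; split; first by apply/direct_inverse; exact: cle_refl.
    by apply: direct_mono; exact: le_top.
  + apply/inside_cle => W w /inside_meet [Tw /inside_direct [V [c [v [rc _ e]]]]].
    apply/inside_direct; exists V, c, v; split=> //.
    by apply/inside_inverse; rewrite e; exact: inside_comp.
- move=> X Y f; have [I [e [m [ef mm re]]]] := regular_factor z proto reg f.
  have km : Ker F f = Ker F e.
    apply: cle_anti; rewrite ef; last exact: Ker_le_comp.
    apply/inside_cle => W w /inside_kernel; rewrite -comp_assoc -(comp0r z W m) => /mm h.
    exact/inside_kernel.
  have im : Im F m = Im F f.
    apply: cle_anti; last by apply/insideE; rewrite ef; exact: inside_Im_comp.
    apply/insideE/inside_direct; exists X, e, (idm X).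
    by split; [| exact: inside_top | rewrite comp_idr].
  exists I, e, m; split=> //; last by rewrite km; exact: regular_epi_quotient.
  split=> // W w /insideE; rewrite -im => /(inside_Im_monic _ mm) [g eg].
  by exists g; split=> // g' eg'; apply: mm; rewrite -eg.
- exact: subobject_join_normal.
- by move=> X S T _ _; exact: subobject_conormal.
Qed.

(** The reflexive graph with vertices [X] and edges [X + M], whose ends are the copairings of the
    identity with [0] and with [m], identifies [m] with zero. Every [f] that kills [m] takes equal
    values on the two ends, so its kernel contains that of [q]. *)
Lemma subobject_normal_closure (X : C) (S : cluster F X) :
  exists T : cluster F X, [/\ normal_cluster T, cle S T
    & forall U, normal_cluster U -> cle S U -> cle T U].
Proof.
have [M [m [mm hm]]] := inside_monicP S.
have [P [i [j [cop cop_eq]]]] := finite_coproducts_binary sums X M.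
have [a [ai aj]] := cop _ (idm X) (@zero C z M X).
have [b [bi bj]] := cop _ (idm X) m.
have [Q [q [qab kq]]] := reflexive_graph_quotient z proto reg bp effective ai bi.
exists (Ker F q); split; first by exists Q, q.
  apply/inside_cle => W w /hm [g ->]; apply/inside_kernel.
  by rewrite comp_assoc -bj (comp_assoc q) -qab -(comp_assoc q) aj comp0r comp0l.
move=> U [Y [f <-]] /inside_cle Sf; apply/inside_cle => W w /inside_kernel/kq.
move=> [V [c [g [rc ag bg]]]]; apply: (inside_local rc); apply/inside_kernel.
have fm : f ∘ m = 0.
  by apply/inside_kernel/Sf/hm; exists (idm M); rewrite comp_idr.
have fab : f ∘ a = f ∘ b.
  by apply: cop_eq; rewrite -!comp_assoc ?ai ?bi ?aj ?bj // fm comp0r.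
by rewrite -bg comp_assoc -fab -comp_assoc ag comp0r.
Qed.

End SubobjectForm.

(** * Decompositions and uniqueness *)


Section Subforms.
Variables (C : category) (F : form C) (P : forall X : C, cluster F X -> Prop).

Lemma sub_mkK (X : C) (S : cluster F X) (PS : P S) : sub_val (sub_mk PS) = S.
Proof. by case: S PS. Qed.

Lemma sub_valP (X : C) (S : cluster (subform P) X) : P (sub_val S).
Proof. by case: S => [[A PA] e]; case: X / e. Qed.

Lemma sub_val_inj (X : C) (S T : cluster (subform P) X) :
  sub_val S = sub_val T -> S = T.
Proof.
case: S T => [[A PA] eA] [[B PB] eB] e.
have /= AB := congr1 (fun U : cluster F X => sval U) e.
case: B / AB PB eB {e} => PB eB /=; case: _ / (proof_irrelevance _ PA PB).
by congr exist; exact: proof_irrelevance.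
Qed.

End Subforms.

(** * Forms fixed by an idempotent operator *)

Section FixedForms.
Variables (C : category) (F : orean_form C) (tau : operator F F).
Hypothesis tau_idem : Defs.idempotent_op tau.

Let mk (X : C) (S : cluster F X) : cluster (fixed_form tau) X := fixed_proj tau_idem X S.

Lemma fixed_projK (X : C) (S : cluster F X) : sub_val (fixed_proj tau_idem X S) = tau X S.
Proof. exact: sub_mkK. Qed.

(** Applying [tau] to the relation leaves the fixed side unchanged. With its counterpart
    [fixed_proj_le], this transfers each universal property from [F]. *)
Lemma fixed_le_proj (X Y : C) (f : hom X Y) (S : cluster (fixed_form tau) X)
    (T : cluster F Y) :
  cgeq f T (sub_val S) -> cgeq f (fixed_proj tau_idem Y T) S.
Proof.
move=> h; change (cgeq f (sub_val (mk T)) (sub_val S)).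
by rewrite fixed_projK -[sub_val S](sub_valP S); exact: op_mono.
Qed.

Lemma fixed_proj_le (X Y : C) (f : hom X Y) (S : cluster F X)
    (T : cluster (fixed_form tau) Y) :
  cgeq f (sub_val T) S -> cgeq f T (fixed_proj tau_idem X S).
Proof.
move=> h; change (cgeq f (sub_val T) (sub_val (mk S))).
by rewrite fixed_projK -[sub_val T](sub_valP T); exact: op_mono.
Qed.

Definition fixed_orean : orean (fixed_form tau).
Proof.
apply: (@Orean C (fixed_form tau) (fun X => mk (fbot F X)) (fun X => mk (ftop F X))
  (fun X S T => mk (fjoin (sub_val S) (sub_val T)))
  (fun X S T => mk (fmeet (sub_val S) (sub_val T)))
  (fun X Y f S => mk (direct f (sub_val S)))
  (fun X Y f T => mk (inverse f (sub_val T)))).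
- by move=> X S; apply: fixed_proj_le; exact: ge_bot.
- by move=> X S; apply: fixed_le_proj; exact: le_top.
- move=> X S T; split; [apply: fixed_le_proj; exact: le_joinl
    | apply: fixed_le_proj; exact: le_joinr |].
  by move=> U SU TU; apply: fixed_proj_le; apply/join_le.
- move=> X S T; have [l r] := (le_meet _ _ _).1 (cle_refl (fmeet (sub_val S) (sub_val T))).
  split; [exact: fixed_proj_le | exact: fixed_proj_le |].
  by move=> U US UT; apply: fixed_le_proj; apply/le_meet.
- move=> X Y Z f g A D h; exists (mk (inverse g (sub_val D))); split.
    by apply: fixed_proj_le; apply/inverse_cgeq; exact: cle_refl.
  by apply: fixed_le_proj; apply/cgeq_factors.
- move=> X Y f S; split=> [|T h]; last by apply: fixed_proj_le; apply/direct_cgeq.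
  by apply: fixed_le_proj; apply/direct_cgeq; exact: cle_refl.
- move=> X Y f T; split=> [|S h]; last by apply: fixed_le_proj; apply/inverse_cgeq.
  by apply: fixed_proj_le; apply/inverse_cgeq; exact: cle_refl.
Defined.

Definition fixed_orean_form : orean_form C := OreanForm fixed_orean.

Lemma fixed_Im (X Y : C) (f : hom X Y) : tau X (ftop F X) = ftop F X ->
  sub_val (Im fixed_orean_form f) = tau Y (Im F f).
Proof. by move=> e; rewrite [LHS]fixed_projK fixed_projK e. Qed.

Lemma fixed_Ker (X Y : C) (f : hom X Y) : tau Y (fbot F Y) = fbot F Y ->
  sub_val (Ker fixed_orean_form f) = tau X (Ker F f).
Proof. by move=> e; rewrite [LHS]fixed_projK fixed_projK e. Qed.

End FixedForms.

Section Decompositions.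
Local Open Scope cat_scope.
Variables (C : category) (F : orean_form C).

Definition id_operator : operator F F :=
  @Operator C F F (fun X S => S) (fun _ _ _ _ _ h => h).

Definition comp_operator (G H K : form C) (s : operator H K) (t : operator G H) :
    operator G K :=
  @Operator C G K (fun X S => s X (t X S)) (fun _ _ _ _ _ h => op_mono s (op_mono t h)).

Lemma normal_inverse (X Y : C) (f : hom X Y) (T : cluster F Y) :
  normal_cluster T -> normal_cluster (inverse f T).
Proof. by move=> [Z [g <-]]; exists Z, (g ∘ f); exact: Ker_comp. Qed.

(** The closure is an operator because inverse images of normal clusters are normal. It fixes top,
    bottom and all kernels, so the fixed form has the kernels of [F] and the closures of its images;
    exactness follows. *)
Lemma normal_closure_emd : conormal_form F -> noetherian F ->
  (forall X, normal_cluster (ftop F X)) ->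
  (forall (X : C) (S : cluster F X), exists T : cluster F X,
     [/\ normal_cluster T, cle S T
       & forall U, normal_cluster U -> cle S U -> cle T U]) ->
  emd_noetherian F.
Proof.
move=> conF noeth top_normal closure; split=> //.
have choice X (S : cluster F X) := constructive_indefinite_description _ (closure X S).
pose cl X (S : cluster F X) := sval (choice X S).
have cl_normal X (S : cluster F X) : normal_cluster (cl X S).
  by have [] := svalP (choice X S).
have le_cl X (S : cluster F X) : cle S (cl X S).
  by have [] := svalP (choice X S).
have cl_le X (S U : cluster F X) : normal_cluster U -> cle S U -> cle (cl X S) U.
  by have [_ _] := svalP (choice X S); apply.
have cl_id X (S : cluster F X) : normal_cluster S -> cl X S = S.
  by move=> nS; apply: cle_anti (le_cl _ _); apply: cl_le => //; exact: cle_refl.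
have cl_mono X Y (f : hom X Y) (S : cluster F X) (T : cluster F Y) :
    cgeq f T S -> cgeq f (cl Y T) (cl X S).
  move=> h; apply/inverse_cgeq/cl_le; first exact: normal_inverse.
  by apply/inverse_cgeq; apply: cgeq_cle h (cle_refl _) (le_cl _ _).
pose ke : operator F F := Operator cl_mono.
have ke_idem : Defs.idempotent_op ke by move=> X S; apply: cl_id.
have id_idem : Defs.idempotent_op id_operator by [].
have KerN X Y (f : hom X Y) : normal_cluster (Ker F f) by exists Y, f.
have ke_top X : ke X (ftop F X) = ftop F X by exact: cl_id.
have ke_bot X : ke X (fbot F X) = fbot F X by apply: cl_id; rewrite -Ker_id.
have ImS X Y (f : hom X Y) := @fixed_Im C F id_operator id_idem X Y f erefl.
have KerS X Y (f : hom X Y) := @fixed_Ker C F id_operator id_idem X Y f erefl.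
have ImE X Y (f : hom X Y) := @fixed_Im C F ke ke_idem X Y f (ke_top X).
have KerE X Y (f : hom X Y) : sub_val (Ker (fixed_orean_form ke_idem) f) = Ker F f.
  by rewrite fixed_Ker // /ke /= cl_id.
have meet_dec : decomposes_by id_operator ke TMeet.
  move=> X S /=; apply: cle_anti; last first.
    by have [] := (le_meet _ _ _).1 (cle_refl (fmeet S (cl X S))).
  by apply/le_meet; split; [exact: cle_refl | exact: le_cl].
have conS : conormal_form (fixed_orean_form id_idem).
  move=> X S; have [W [f ef]] := conF X (sub_val S); exists W, f.
  by apply: sub_val_inj; rewrite ImS.
have norE : normal_form (fixed_orean_form ke_idem).
  move=> X S; have [W [f ef]] := cl_normal X (sub_val S); exists W, f.
  by apply: sub_val_inj; rewrite KerE ef; exact: sub_valP S.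
pose D := @Decomposition C F id_operator ke id_idem ke_idem (fixed_orean id_idem)
  (fixed_orean ke_idem) conS norE (ex_intro _ TMeet meet_dec).
have in_s : conormal_op (incl_s D) by move=> X Y f; exact: ImS.
have in_e : normal_op (incl_e D) by move=> X Y f; exact: KerE.
have bi_s : binormal_op (tau_s D).
  by split=> X Y f; apply: sub_val_inj; rewrite [LHS]fixed_projK ?ImS ?KerS.
have bi_e : binormal_op (tau_e D).
  split=> X Y f; apply: sub_val_inj; rewrite [LHS]fixed_projK ?ImE // KerE.
  exact: cl_id.
exists D; split=> //; split=> //.
(* Both required operators are an inclusion into [F] followed by the other projection. *)
- exists (comp_operator (tau_e D) (incl_s D)) => X Y f.
  by rewrite -(bi_e.1 X Y f) -(in_s X Y f).
- exists (comp_operator (tau_s D) (incl_e D)) => X Y f.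
  by rewrite -(bi_s.2 X Y f) -(in_e X Y f).
Qed.

Section MeetDecomposition.
Variable D : decomposition F.
Hypotheses (exact_D : exact_decomposition D) (meet_D : meet_decomposition D).

Lemma le_kap (X : C) (S : cluster F X) : cle S (kap_s D X S) /\ cle S (kap_e D X S).
Proof. by rewrite {1 3}(meet_D S); apply/le_meet; exact: cle_refl. Qed.

Lemma kap_s_conormal (X : C) (S : cluster F X) : conormal_cluster (kap_s D X S).
Proof.
have [_ _ _ in_s _] := exact_D.
have [W [f ef]] := dec_s_conormal (tau_s D X S); exists W, f.
by rewrite -(in_s _ _ f) ef; exact: fixed_projK.
Qed.

Lemma kap_s_id (X : C) (S : cluster F X) : conormal_cluster S -> kap_s D X S = S.
Proof.
have [_ _ _ in_s _] := exact_D.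
by move=> [W [f <-]]; rewrite -(in_s _ _ f); exact: sub_valP (Im (form_s D) f).
Qed.

Lemma kap_e_normal (X : C) (S : cluster F X) : normal_cluster (kap_e D X S).
Proof.
have [_ _ _ _ in_e] := exact_D.
have [W [f ef]] := dec_e_normal (tau_e D X S); exists W, f.
by rewrite -(in_e _ _ f) ef; exact: fixed_projK.
Qed.

(* [kap_s] sends the inverse image of a conormal cluster below itself because
   [kap_s] is an operator, and above itself because of the meet decomposition. *)
Lemma emd_inverse_conormal (X Y : C) (f : hom X Y) (T : cluster F Y) :
  conormal_cluster T -> conormal_cluster (inverse f T).
Proof.
move=> cT; suff <- : kap_s D X (inverse f T) = inverse f T by exact: kap_s_conormal.
apply: cle_anti (le_kap _).1; apply/inverse_cgeq.
rewrite -{1}(kap_s_id cT); apply: op_mono; apply/inverse_cgeq; exact: cle_refl.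
Qed.

(** Every morphism out of the zero object is split mono, so normal clusters there are bottom; and
    top lies below its [kap_e], which is normal. *)
Lemma emd_top_zero (z : zero_family C) : ftop F (zero_ob z) = fbot F (zero_ob z).
Proof.
have [Y [f ef]] := kap_e_normal (ftop F (zero_ob z)).
apply: le_bot; apply: cle_trans (le_kap _).2 _; rewrite -ef.
rewrite (split_mono_Ker _ (p := @zero C z Y (zero_ob z))); first exact: cle_refl.
by rewrite comp0l zero_ob_id.
Qed.

Lemma emd_bot_conormal (z : zero_family C) (X : C) : conormal_cluster (fbot F X).
Proof.
exists (zero_ob z), (@zero C z (zero_ob z) X).
by rewrite /Im emd_top_zero; exact: direct_bot.
Qed.

Lemma emd_top_normal (X : C) : normal_cluster (ftop F X).
Proof.
rewrite -(top_le (S := kap_e D X (ftop F X))); first exact: kap_e_normal.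
exact: (le_kap _).2.
Qed.

End MeetDecomposition.

(* The morphism from the initial to the terminal object has zero kernel and full
   image, since both objects have a single cluster. *)
Lemma conormal_emd_pointed : has_finite_products C -> has_finite_coproducts C ->
  conormal_form F -> emd_noetherian F -> pointed C.
Proof.
move=> hp hc conF [noeth [D [exD meetD]]].
have [T [pT hT]] := hp void (fun v : void => match v with end).
have [I [iI hI]] := hc void (fun v : void => match v with end).
have terminal : is_terminal T.
  by move=> X; have [u [_ uu]] := hT X (fun v => match v with end);
     exists u; split=> // v _; apply: uu; case.
have initial : is_initial I.
  by move=> X; have [u [_ uu]] := hI X (fun v => match v with end);
     exists u; split=> // v _; apply: uu; case.
have eqT X (f g : hom X T) : f = g.
  by have [t [_ ut]] := terminal X; rewrite -(ut f) // -(ut g).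
have eqI X (f g : hom I X) : f = g.
  by have [t [_ ut]] := initial X; rewrite -(ut f) // -(ut g).
have [h _] := initial T.
(* Bottom is the image of some [f], which is split epi by initiality, so this image is top. Dually,
   top on [T] is a kernel of a split mono. *)
have top_bot_I : ftop F I = fbot F I.
  have [W [f ef]] := conF I (fbot F I); have [i _] := initial W.
  by rewrite -ef; apply: esym; apply: (split_epi_Im _ (s := i)).
have top_bot_T : ftop F T = fbot F T.
  have [Y [f ef]] := emd_top_normal exD meetD T; have [t _] := terminal Y.
  by rewrite -ef; apply: (split_mono_Ker _ (p := t)).
have kh : Ker F h = fbot F I by apply: le_bot; rewrite -top_bot_I; exact: le_top.
have ih : Im F h = ftop F T by apply: top_le; rewrite top_bot_T; exact: ge_bot.
have := Ker_bot_embedding noeth kh; rewrite ih => /embedding_top_iso [k [k_h _]].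
exists I; split=> // X; have [t _] := terminal X.
exists (k ∘ t); split=> // f _.
by rewrite -(comp_idl f) -k_h -comp_assoc (eqT _ (h ∘ f) t).
Qed.


End Decompositions.

(** * Uniqueness of the conormal noetherian form *)

Section Uniqueness.
Local Open Scope cat_scope.
Variables (C : category) (z : zero_family C).

Lemma conormal_inverse (F : orean_form C) : conormal_form F ->
  forall (X Y : C) (f : hom X Y) (T : cluster F Y),
    conormal_cluster T -> conormal_cluster (inverse f T).
Proof. by move=> conF X Y f T _; exact: conF. Qed.

Lemma Im_factors_le (G : orean_form C) (X Y U V : C) (f : hom X Y) (m : hom U X)
    (n : hom V Y) :
  factors_through (f ∘ m) n -> cgeq f (Im G n) (Im G m).
Proof.
move=> [g e]; apply/direct_cgeq; rewrite -Im_comp e; apply/insideE.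
exact: inside_Im_comp.
Qed.

(* Every monomorphism is an embedding in both forms, so clusters correspond via
   the embeddings representing them. *)
Lemma conormal_noetherian_unique (F G : orean_form C) :
  conormal_form F -> noetherian F -> conormal_form G -> noetherian G ->
  isomorphic_forms F G.
Proof.
move=> conF nF conG nG.
have embF X (S : cluster F X) : {M : C & {m : hom M X | is_embedding S m}}.
  have [M hM] := constructive_indefinite_description _ (conormal_embedding nF (conF X S)).
  by exists M; apply: constructive_indefinite_description.
have embG X (S : cluster G X) : {M : C & {m : hom M X | is_embedding S m}}.
  have [M hM] := constructive_indefinite_description _ (conormal_embedding nG (conG X S)).
  by exists M; apply: constructive_indefinite_description.
have factor (H : orean_form C) (nH : noetherian H) X Y (f : hom X Y) (S : cluster H X)
    (T : cluster H Y) M (m : hom M X) N (n : hom N Y) :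
    is_embedding S m -> is_embedding T n -> cgeq f T S -> factors_through (f ∘ m) n.
  move=> [em _] hn h; apply/(embedding_inside _ hn)/insideE.
  by rewrite Im_comp em; apply/direct_cgeq.
pose s X (S : cluster F X) := Im G (sval (projT2 (embF X S))).
pose t X (S : cluster G X) := Im F (sval (projT2 (embG X S))).
have s_mono X Y (f : hom X Y) S T : cgeq f T S -> cgeq f (s Y T) (s X S).
  move=> h; apply: Im_factors_le; apply: factor h => //; exact: svalP.
have t_mono X Y (f : hom X Y) S T : cgeq f T S -> cgeq f (t Y T) (t X S).
  move=> h; apply: Im_factors_le; apply: factor h => //; exact: svalP.
(* In [K] both [m] and [n] embed [Im K m], so they factor through each other and have the same image
   in [H]. *)
have round (H K : orean_form C) (nH : noetherian H) (nK : noetherian K)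
    (conK : conormal_form K) X (S : cluster H X) M (m : hom M X) N (n : hom N X) :
    is_embedding S m -> is_embedding (Im K m) n -> Im H n = S.
  move=> hm hn; have hm' : is_embedding (Im K m) m.
    apply: (monic_embedding nK z) (embedding_monic hm); first exact: conormal_inverse.
    by move=> Y; exact: conK.
  rewrite -hm.1; apply: cle_anti.
    by rewrite /cle; apply: Im_factors_le; apply: factor hn hm' (cle_refl _).
  by rewrite /cle; apply: Im_factors_le; apply: factor hm' hn (cle_refl _).
exists (Operator s_mono), (Operator t_mono); split=> X S /=.
  by apply: (round F G) (svalP (projT2 (embF X S))) (svalP (projT2 (embG X _))).
by apply: (round G F) (svalP (projT2 (embG X S))) (svalP (projT2 (embF X _))).
Qed.

End Uniqueness.

Lemma semi_abelian_form (C : category) :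
  has_finite_products C -> has_finite_coproducts C -> semi_abelian C ->
  exists F : orean_form C, conormal_form F /\ emd_noetherian F.
Proof.
move=> hp hc [/pointed_zero [z] _ [reg eff] proto].
have [bp] := finite_products_binary hp.
exists (subobject_orean_form z proto reg hc).
split; first exact: subobject_conormal.
apply: normal_closure_emd.
- exact: subobject_conormal.
- exact: subobject_noetherian.
- move=> X; exists (zero_ob z), (@zero C z X (zero_ob z)).
  by apply: top_le; apply/inside_cle => W w _; apply/inside_kernel; rewrite comp0l.
- exact: subobject_normal_closure.
Qed.

Lemma noetherian_semi_abelian (C : category) (F : orean_form C) :
  has_finite_products C -> has_finite_coproducts C -> pointed C -> noetherian F ->
  (forall (X Y : C) (f : hom X Y) (T : cluster F Y),
     conormal_cluster T -> conormal_cluster (inverse f T)) ->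
  (forall X : C, conormal_cluster (fbot F X)) -> semi_abelian C.
Proof.
move=> hp hc pC nF inv bot; have [z] := pointed_zero pC.
have [bp] := finite_products_binary hp; split=> //.
  split; first exact: (noetherian_regular nF z inv bot bp hp).
  exact: (noetherian_effective nF z inv bot bp).
exact: (noetherian_protomodular nF z inv bot bp).
Qed.

Theorem theorem179 (C : category)
  (C_products : has_finite_products C) (C_sums : has_finite_coproducts C) :
  (forall F G : orean_form C,
     conormal_form F -> emd_noetherian F ->
     conormal_form G -> emd_noetherian G -> isomorphic_forms F G)
  /\
  [<-> (* (i) *)
       exists F : orean_form C, conormal_form F /\ emd_noetherian F;
       (* (ii) *)
       pointed C /\ exists F : orean_form C, emd_noetherian F;
       (* (iii) *)
       pointed C /\ (exists F : orean_form C,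
         [/\ conormal_form F, noetherian F & has_exact_decomposition F]);
       (* (iv) *)
       pointed C /\ (exists F : orean_form C, conormal_form F /\ noetherian F);
       (* (v) *)
       pointed C /\ (exists F : orean_form C,
         [/\ noetherian F,
             forall (X Y : C) (f : hom X Y) (T : cluster F Y),
               conormal_cluster T -> conormal_cluster (inverse f T)
           & forall X : C, conormal_cluster (fbot F X)]);
       (* (vi) *)
       semi_abelian C].
Proof.
split=> [F G conF emdF conG emdG|].
  have [z] := pointed_zero (conormal_emd_pointed C_products C_sums conF emdF).
  exact: (conormal_noetherian_unique z conF emdF.1 conG emdG.1).
tfae.
- move=> [F [conF emdF]]; split; last by exists F.
  exact: conormal_emd_pointed conF emdF.
(* The form required by (iii) is not the given one: (ii) makes the category semi-abelian, and
   [semi_abelian_form] then supplies a conormal form. *)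
- move=> [pC [F [nF [D [exD meetD]]]]]; split=> //; have [z] := pointed_zero pC.
  have [|G [conG [nG [E [exE _]]]]] := @semi_abelian_form C C_products C_sums.
    apply: noetherian_semi_abelian pC nF _ _ => //.
      exact: emd_inverse_conormal exD meetD.
    exact: emd_bot_conormal exD meetD z.
  by exists G; split=> //; exists E.
- by move=> [pC [F [conF nF _]]]; split=> //; exists F.
- move=> [pC [F [conF nF]]]; split=> //; exists F; split=> // *; exact: conF.
- by move=> [pC [F [nF inv bot]]]; exact: noetherian_semi_abelian pC nF inv bot.
- exact: semi_abelian_form.
Qed.
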